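(* Let $n,r$ be integers. (i) For $n\ge r\ge 56$, $\mathrm{sat}(n,\mathcal{C}_{\ge r})\le g\left(\frac{r}{n}\right)n+O\left(\frac{n}{r}\right)$. (ii) For $28\le \frac{n}{2}\le r\le n$, $\mathrm{sat}(n,\mathcal{C}_{\ge r})=n+\left\lceil\frac{r}{2}\right\rceil$.
   Context: All graphs are finite and simple. For an integer $r\ge 3$, $\mathcal{C}_{\ge r}$ denotes the family of all cycles of length at least $r$. For a family $\mathcal{F}$ of graphs, a graph $G$ is $\mathcal{F}$-saturated if $G$ contains no subgraph isomorphic to any member of $\mathcal{F}$, but for every pair of distinct nonadjacent vertices of $G$, adding the edge $e$ joining them yields a graph $G+e$ containing a copy of some member of $\mathcal{F}$ as a subgraph. The saturation number $\mathrm{sat}(n,\mathcal{F})$ is the minimum number of edges in an $n$-vertex $\mathcal{F}$-saturated graph. The function $g$ is defined on $(0,1]\cap\mathbb{Q}$ by $$g(x)=\begin{cases}1+\frac{1}{2}x, & x\in[\frac12,1],\\ 1+\frac{k}{2}x, & x\in(\frac{1}{2k},\frac{2}{4k-3}],\\ 2-\frac{3k-3}{2}x, & x\in(\frac{2}{4k-3},\frac{1}{2k-2}],\end{cases}$$ where $k$ ranges over the integers $k\ge 2$ (the two formulas applicable at $x=\frac12$ agree). The constant implied in $O(\cdot)$ is absolute (independent of $n$ and $r$). *)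

(* Defs.v *)
From HB Require Import structures.
From mathcomp Require Import all_boot all_order all_algebra.
From mathcomp Require Import boolp.
From mathcomp Require Import ring lra zify.

Set Implicit Arguments.
Unset Strict Implicit.
Unset Printing Implicit Defensive.

Import Order.TTheory GRing.Theory Num.Theory.

(* A finite simple graph on V, given by its set of edges, each of which is a  *)
(* 2-element set of vertices.                                                 *)
Definition vpairs (V : finType) : {set {set V}} := [set e : {set V} | #|e| == 2].

Record sgraph (V : finType) := SGraph {
  edges : {set {set V}};
  edges_pairs : edges \subset vpairs V
}.

HB.instance Definition _ (V : finType) := [isSub for @edges V].
HB.instance Definition _ (V : finType) := [Finite of sgraph V by <:].

Definition adj (V : finType) (G : sgraph V) (u v : V) : bool :=
  [set u; v] \in edges G.

Definition mkgraph (V : finType) (E : {set {set V}}) : sgraph V :=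
  SGraph (subsetIr E (vpairs V)).

Definition add_edge (V : finType) (G : sgraph V) (u v : V) : sgraph V :=
  mkgraph ([set u; v] |: edges G).

(* Injective homomorphisms H -> G correspond to subgraphs of G (not           *)
(* necessarily induced) together with an isomorphism from H.                  *)
Definition has_copy (V W : finType) (H : sgraph W) (G : sgraph V) : Prop :=
  exists f : W -> V,
    injective f /\ forall u v, adj H u v -> adj G (f u) (f v).

Definition graph_family : Type := forall m : nat, sgraph 'I_m -> Prop.

Definition contains (F : graph_family) (V : finType) (G : sgraph V) : Prop :=
  exists (m : nat) (H : sgraph 'I_m), F m H /\ has_copy H G.

Definition saturated (F : graph_family) (V : finType) (G : sgraph V) : Prop :=
  ~ contains F G /\
  forall u v : V, u != v -> ~~ adj G u v -> contains F (add_edge G u v).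

(* The default value 'C(n, 2) bounds the number of edges of every graph, so   *)
(* it plays no role as soon as a saturated graph exists; see [sat_min].       *)
Definition sat (n : nat) (F : graph_family) : nat :=
  \big[minn/'C(n, 2)]_(G : sgraph 'I_n | `[< saturated F G >]) #|edges G|.

(* [ordS] is the cyclic successor of 'I_m; this is the cycle of length m when *)
(* m >= 3.                                                                    *)
Definition cycle_graph (m : nat) : sgraph 'I_m :=
  mkgraph [set [set i; ordS i] | i : 'I_m].

Definition cycles_ge (r : nat) : graph_family :=
  fun m H => r <= m /\ H = cycle_graph m.

Section Checks.

Variable V : finType.
Implicit Types (G : sgraph V) (u v x y : V).

Lemma adjC G u v : adj G u v = adj G v u.
Proof. by rewrite /adj setUC. Qed.

Lemma adj_irr G u : adj G u u = false.
Proof.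
apply/negP => /(subsetP (edges_pairs G)).
by rewrite inE setUid cards1.
Qed.

Lemma adj_mkgraph (E : {set {set V}}) u v :
  adj (mkgraph E) u v = ([set u; v] \in E) && (u != v).
Proof. by rewrite /adj /= !inE cards2; case: (u != v). Qed.

Lemma set2_eq u v x y :
  ([set x; y] == [set u; v]) =
  ((x == u) && (y == v)) || ((x == v) && (y == u)).
Proof.
apply/eqP/orP => [E|[] /andP[/eqP-> /eqP->] //]; last by rewrite setUC.
have := set22 u v; have := set21 u v; rewrite -E => /set2P hu /set2P hv.
have := set22 x y; have := set21 x y; rewrite E => /set2P hx /set2P hy.
by case: hx => ?; case: hy => ?; case: hu => ?; case: hv => ?; subst;
   rewrite ?eqxx ?orbT; auto.
Qed.

Lemma adj_add_edge G u v x y : u != v ->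
  adj (add_edge G u v) x y =
  [|| adj G x y, (x == u) && (y == v) | (x == v) && (y == u)].
Proof.
move=> uv; rewrite adj_mkgraph in_setU1 set2_eq orbC -/(adj G x y).
have [->|xy] := eqVneq x y; last by rewrite andbT.
rewrite adj_irr andbF /=; apply/esym/negbTE; apply: contra uv.
by case/orP=> /andP[/eqP<- /eqP<-].
Qed.

Lemma edges_add_edge G u v :
  u != v -> edges (add_edge G u v) = [set u; v] |: edges G.
Proof.
move=> uv; apply/setIidPl; rewrite subUset sub1set edges_pairs andbT.
by rewrite inE cards2 uv.
Qed.

Lemma card_edges G : #|edges G| <= 'C(#|V|, 2).
Proof.
by rewrite -[#|V|]cardsT -cards_draws; apply/subset_leq_card/subsetP=> e
   /(subsetP (edges_pairs G)); rewrite !inE subsetT.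
Qed.

End Checks.

Lemma adj_cycle_graph m (i j : 'I_m) : 2 < m ->
  adj (cycle_graph m) i j = (j == ordS i) || (i == ordS j).
Proof.
move=> m3; rewrite adj_mkgraph.
have S (k : 'I_m) : k != ordS k.
  apply/eqP=> /(congr1 val) /=; case: k => k km /=.
  have [k1|] := ltnP k.+1 m; first by rewrite modn_small //; lia.
  move=> mk; have em : k.+1 = m by apply/eqP; rewrite eqn_leq km.
  by rewrite em modnn => k0; rewrite -em k0 in m3.
apply/andP/orP => [[/imsetP[k _ /eqP]]|].
  by rewrite set2_eq => /orP[] /andP[/eqP-> /eqP->] _; [left|right].
case=> /eqP ->; split; rewrite ?S 1?eq_sym ?S //.
  by apply/imsetP; exists i.
by apply/imsetP; exists j; rewrite // setUC.
Qed.

Lemma sat_min n (F : graph_family) :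
  (exists G : sgraph 'I_n, saturated F G) ->
  (exists2 G : sgraph 'I_n, saturated F G & #|edges G| = sat n F) /\
  (forall G : sgraph 'I_n, saturated F G -> sat n F <= #|edges G|).
Proof.
case=> G0 sG0.
have leS (G : sgraph 'I_n) : saturated F G -> sat n F <= #|edges G|.
  move=> /asboolP sG; rewrite /sat; have := mem_index_enum G.
  elim: (index_enum _) => // H s IHs; rewrite inE big_cons.
  case/predU1P => [<-|/IHs le_s]; first by rewrite sG geq_minl.
  by case: ifP => // _; apply: leq_trans (geq_minr _ _) le_s.
split=> //.
suff: (exists2 G : sgraph 'I_n, saturated F G & #|edges G| = sat n F)
  \/ sat n F = 'C(n, 2).
  case=> // E; exists G0 => //; apply/eqP; rewrite eqn_leq leS // andbT E.
  by have := card_edges G0; rewrite card_ord.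
rewrite /sat; elim/big_ind: _ => [|x y|G /asboolP sG]; first by right.
  by rewrite /minn; case: ifP.
by left; exists G.
Qed.

Lemma saturated_cycles_ge_ex n r : 2 < r ->
  exists G : sgraph 'I_n, saturated (cycles_ge r) G.
Proof.
move=> r3.
have free0 : ~ contains (cycles_ge r) (mkgraph (set0 : {set {set 'I_n}})).
  case=> m [H [[rm ->] [f [_ fh]]]].
  have m0 : 0 < m by lia.
  have := fh (Ordinal m0) (ordS (Ordinal m0)).
  rewrite adj_cycle_graph ?eqxx; last by lia.
  by move/(_ isT); rewrite adj_mkgraph inE.
have P0 : `[< ~ contains (cycles_ge r) (mkgraph (set0 : {set {set 'I_n}})) >].
  exact/asboolP.
pose P (G : sgraph 'I_n) := `[< ~ contains (cycles_ge r) G >].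
case: (@arg_maxnP _ _ P (fun G => #|edges G|) P0) => G /asboolP fG maxG.
exists G; split=> // u v uv nuv; apply: contrapT => /asboolP /maxG.
have c : #|edges (add_edge G u v)| = #|edges G|.+1.
  by rewrite (edges_add_edge G uv) cardsU1 -/(adj G u v) nuv.
by move=> h; have := leq_trans (eq_leq (esym c)) h; rewrite ltnn.
Qed.

Local Open Scope ring_scope.

(* For 0 < x <= 1/2, [gk x] is the unique integer k >= 2 such that            *)
(* 1/(2k) < x <= 1/(2k-2).  The lemmas [gE1], [gE2], [gE3] below give the     *)
(* usual presentation of g.                                                   *)
Definition gk (x : rat) : nat := (Num.truncn ((2 * x)^-1)).+1.

Definition g (x : rat) : rat :=
  let k : rat := (gk x)%:R in
  if 1 / 2 <= x then 1 + 1 / 2 * x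
  else if x <= 2 / (4 * k - 3) then 1 + k / 2 * x
  else 2 - (3 * k - 3) / 2 * x.

Lemma gkE (x : rat) (k : nat) : (2 <= k)%N ->
  1 / (2 * k%:R) < x -> x <= 1 / (2 * k%:R - 2) -> gk x = k.
Proof.
case: k => [|k] // k1; rewrite -[k.+1%:R]natr1.
have kp : (0 : rat) < k%:R by rewrite ltr0n.
set K : rat := k%:R in kp * => xl xu.
have xp : 0 < x by apply: le_lt_trans xl; rewrite divr_ge0 //; lra.
have e1 : 2 * (K + 1) - 2 = 2 * K by ring.
have K2 : 0 < 2 * (K + 1) by lra.
have K1 : 0 < 2 * K by lra.
rewrite ltr_pdivrMr // in xl; rewrite e1 ler_pdivlMr // in xu.
congr _.+1; apply/truncn_def.
rewrite -/K -[k.+1%:R]natr1 -/K.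
have x2 : 0 < 2 * x by lra.
rewrite -[_^-1]mul1r ler_pdivlMr // ltr_pdivrMr //; apply/andP; split; lra.
Qed.

Lemma gE1 (x : rat) : 1 / 2 <= x <= 1 -> g x = 1 + 1 / 2 * x.
Proof. by case/andP => h _; rewrite /g h. Qed.

Lemma gE2 (x : rat) (k : nat) : (2 <= k)%N ->
  1 / (2 * k%:R) < x <= 2 / (4 * k%:R - 3) -> g x = 1 + k%:R / 2 * x.
Proof.
move=> k2 /andP[xl xu]; have kp : (2 : rat) <= k%:R by rewrite ler_nat.
have xh : x < 1 / 2.
  apply: le_lt_trans xu _; rewrite ltr_pdivrMr; lra.
have ek : gk x = k.
  apply: gkE => //; apply: le_trans xu _.
  rewrite ler_pdivrMr; last lra.
  rewrite mulrAC ler_pdivlMr; lra.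
by rewrite /g ek xu lt_geF.
Qed.

Lemma gE3 (x : rat) (k : nat) : (2 <= k)%N ->
  2 / (4 * k%:R - 3) < x <= 1 / (2 * k%:R - 2) ->
  g x = 2 - (3 * k%:R - 3) / 2 * x.
Proof.
move=> k2 /andP[xl xu]; have kp : (2 : rat) <= k%:R by rewrite ler_nat.
have ek : gk x = k.
  apply: gkE => //; apply: le_lt_trans xl.
  rewrite ler_pdivrMr; last lra.
  rewrite mulrAC ler_pdivlMr; lra.
rewrite /g ek (lt_geF xl); case: ifP => // xh.
have x2 : x <= 1 / 2.
  apply: le_trans xu _; rewrite ler_pdivrMr; lra.
have ex : x = 1 / 2 by apply/eqP; rewrite eq_le x2.
move: xu; rewrite ex ler_pdivlMr => [xu|]; last lra.
have -> : k%:R = 2 :> rat by lra.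
lra.
Qed.

(* Main.v *)
From HB Require Import structures.
Require Import Defs.
From Stdlib Require Import PArith.
From mathcomp Require Import all_boot all_order all_algebra.
From mathcomp Require Import boolp zify ring lra.

Set Implicit Arguments.
Unset Strict Implicit.
Unset Printing Implicit Defensive.

(* Lower bound. Let [S] be a minimal set of at least [r] vertices such that   *)
(* any two nonadjacent vertices of [S] are joined by a path in [S] on at      *)
(* least [r] vertices. If [S] spans fewer than [|S| + r/2] edges, then every  *)
(* vertex of degree 2 in [S] lies in a triangle whose other vertices have     *)
(* degree at least 4, since otherwise a cycle of length [r] or a smaller [S]  *)
(* appears; discharging then gives average degree at least 3. The vertices    *)
(* outside [S] contribute at least one edge each.                             *)
(*                                                                            *)
(* Upper bound. A graph on [r] vertices with [3 r / 2] edges that has no      *)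
(* Hamiltonian cycle, but a Hamiltonian path between any two nonadjacent      *)
(* vertices and a path missing at most one vertex between any two adjacent    *)
(* ones, stays saturated when copies of it are glued at a vertex and when     *)
(* cliques with 2 or 3 vertices are attached. Such a graph is a ring of an    *)
(* odd number of claws, joined along three strands with a twist at each seam, *)
(* where a few claws are enlarged to fit the residue of [r] modulo 8.         *)
(* Hamiltonian paths are found by a finite calculation with linkages, the     *)
(* ways in which disjoint paths covering a run of tiles pair up its ends, as  *)
(* linkages of long runs only depend on parity. A Hamiltonian cycle would use *)
(* two of the three strands at each seam, by the parity of the number of      *)
(* tiles; colouring them according to the position of the unused strand shows *)
(* that the cycle is disconnected. The order [r = 29] needs a special graph.  *)

(** * Paths, cycles and saturation *)

(** The lower bound rests on [avg_degree] and [edges_in_grow]. A minimal set [S] as above has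
    [|S| + r/2] edges, or else average degree at least 3, which gives [3|S|/2 >= |S| + r/2] edges as
    well. By connectivity each vertex outside [S] brings one more edge ([saturated_edges],
    [sat_geq]).

    For the upper bound, [mnh_exists] provides a graph with [r] vertices and [uphalf (3 * r)] edges.
    Gluing [k] copies ([glue_core]) gives [N = k (r - 1) + 1] vertices. A pendant edge costs one
    edge per new vertex, a triangle 3/2 ([sat_hang], [sat_upper]). Pendant edges alone reach
    [n = 2 N] and cost about [n + k r / 2] edges in all; with a pendant edge or a triangle at every
    vertex the total is about [2 n - 3 k r / 2]. For [x < 1/2] the function [g] is the first cost
    with [k = gk x] copies or the second with [k - 1] copies, and these agree at
    [x = 2 / (4 k - 3)]. With one copy and [r <= n <= 2 r] the count is exact ([sat_one]) and meets
    [sat_geq].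

    The graphs come from [ring_exists] and [mnh29]. By [pass_mono2] the paths in rings of all
    lengths reduce to finitely many computations, while [ring_not_hamiltonian] combines one check
    per tile with the oddness of the ring. *)

Section Walks.

Variable T : eqType.
Implicit Types (e : rel T) (s p q : seq T) (u v x y : T).

(** The start [u] is not listed in [p], as in [path], so the path has [(size p).+1] vertices. *)
Definition upath e u v p := [&& path e u p, last u p == v & uniq (u :: p)].

Lemma upath_rev e u v p : symmetric e -> upath e u v p ->
  exists q, [/\ upath e v u q, size q = size p & v :: q =i u :: p].
Proof.
move=> sym /and3P[pp /eqP lp up].
exists (rev (belast u p)); split; first last.
- by move=> x; rewrite -lp -rev_rcons -lastI mem_rev.
- by rewrite size_rev size_belast.
apply/and3P; split.
- by rewrite -lp rev_path; apply: sub_path pp => a b /=; rewrite sym.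
- by case: (p) lp => [/= ->|a l _] //=; rewrite rev_cons last_rcons.
- by rewrite -lp -rev_rcons -lastI rev_uniq.
Qed.

Lemma upath_cat e u w v p q : upath e u w p -> upath e w v q ->
  ~~ has (mem (u :: p)) q -> upath e u v (p ++ q).
Proof.
move=> /and3P[pp /eqP lp up] /and3P[pq /eqP lq].
rewrite cons_uniq => /andP[_ uq] dis.
apply/and3P; split; first by rewrite cat_path pp lp.
  by rewrite last_cat lp lq.
by rewrite -cat_cons cat_uniq up dis.
Qed.

Lemma cycle_nthP (x0 : T) e s :
  reflect (forall i, i < size s -> e (nth x0 s i) (nth x0 s (i.+1 %% size s)))
          (cycle e s).
Proof.
case: s => [|x s]; first by apply: (iffP idP).
rewrite /cycle; apply: (iffP (pathP x0)) => h i; rewrite ?size_rcons => lti.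
  have := h i; rewrite size_rcons => /(_ lti).
  rewrite -rcons_cons nth_rcons lti nth_rcons.
  have [ls|] := ltnP i (size s); first by rewrite modn_small.
  move=> ge; have -> : i = size s by apply/eqP; rewrite eqn_leq ge andbT -ltnS.
  by rewrite eqxx modnn.
have := h i lti; rewrite -rcons_cons nth_rcons lti nth_rcons.
have [ls|] := ltnP i (size s); first by rewrite modn_small.
move=> ge; have -> : i = size s by apply/eqP; rewrite eqn_leq ge andbT -ltnS.
by rewrite eqxx modnn.
Qed.

(** Deleting [c] from a cycle leaves a path, along which [A] is constant. With [c] a cut vertex,
    this confines a cycle to one block. *)
Lemma cycle_cut e s (A : pred T) c : uniq s -> cycle e s ->
  (forall x y, x \in s -> y \in s -> x != c -> y != c -> e x y -> A x = A y) ->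
  has (predI A (predC1 c)) s -> all (predU A (pred1 c)) s.
Proof.
move=> us cs hA /hasP[x xs /andP[/= Ax xc]].
suff key s' : all (mem s) s' -> c \notin s' ->
    (exists2 z, z \in s' & A z) -> sorted e s' -> all A s'.
  have [cin|cout] := boolP (c \in s).
    have [i s' es] := rot_to cin.
    have inS y : (y \in s) = (y \in c :: s') by rewrite -es mem_rot.
    have us' : uniq (c :: s') by rewrite -es rot_uniq.
    have cs' : cycle e (c :: s') by rewrite -es rot_cycle.
    rewrite (eq_all_r inS) /= eqxx orbT /=.
    have xs' : x \in s' by move: xs; rewrite inS inE (negbTE xc).
    suff: all A s' by apply: sub_all => y Ay /=; rewrite Ay.
    apply: key.
    - by apply/allP=> y ys; rewrite /= inS inE ys orbT.
    - by case/andP: us'.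
    - by exists x.
    - move: cs' => /=; rewrite rcons_path => /andP[ps _].
      exact: path_sorted ps.
  suff: all A s by apply: sub_all => y Ay /=; rewrite Ay.
  apply: key => //; first by exists x.
  by case: (s) cs => //= a l; rewrite rcons_path => /andP[].
elim: s' => //= a l IH /andP[ain lin] cl [z zin Az] pl.
move: cl; rewrite inE negb_or => /andP[ca cl].
case: l IH lin cl zin pl => [|b l] IH lin cl zin /=.
  by move: zin; rewrite inE => /eqP <-; rewrite Az.
case/andP => eab pl.
have eqA : A a = A b.
  apply: hA eab => //; first by case/andP: lin.
    by rewrite eq_sym.
  by move: cl; rewrite inE negb_or eq_sym => /andP[].
have : all A (b :: l).
  apply: IH => //; move: zin; rewrite inE => /orP[/eqP ez|]; last by exists z.
  by exists b; rewrite ?inE ?eqxx // -eqA -ez.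
by rewrite eqA => /= /[dup] /andP[-> _] ->.
Qed.

End Walks.

Section Saturation.

Variable V : finType.
Implicit Types (G : sgraph V) (u v : V).

Lemma adj_neq G u v : adj G u v -> u != v.
Proof. by apply: contraTneq => ->; rewrite adj_irr. Qed.

Lemma contains_cycleP r G : 2 < r ->
  contains (cycles_ge r) G <->
  exists s, [/\ uniq s, cycle (adj G) s & r <= size s].
Proof.
move=> r3; split=> [[m [H [[rm ->] [f [fi fh]]]]]|[s [us cs rs]]].
  exists (map f (enum 'I_m)); split.
  - by rewrite map_inj_uniq ?enum_uniq.
  - have i0 : 'I_m by exists 0; lia.
    apply/(cycle_nthP (f i0)) => i; rewrite size_map size_enum_ord => im.
    have im1 : i.+1 %% m < m by rewrite ltn_mod; lia.
    have nE j : j < m -> nth (f i0) [seq f i | i <- enum 'I_m] j =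
        f (nth i0 (enum 'I_m) j).
      by move=> jm; rewrite (nth_map i0) ?size_enum_ord.
    rewrite !nE //; apply: fh; rewrite adj_cycle_graph; last lia.
    apply/orP; left; apply/eqP/val_inj.
    have oS (k : 'I_m) : val (ordS k) = k.+1 %% m by [].
    rewrite oS.
    by rewrite [val _](nth_enum_ord _ im1) [in RHS](nth_enum_ord _ im).
  - by rewrite size_map size_enum_ord.
have x0 : V by case: s rs {us cs} => [|x s _] /=; [lia | exact: x].
exists (size s), (cycle_graph (size s)); split=> //.
exists (fun i : 'I_(size s) => nth x0 s i); split.
  move=> i j /= eij; apply/val_inj/eqP.
  by have := nth_uniq x0 (ltn_ord i) (ltn_ord j) us; rewrite eij eqxx => <-.
move=> i j; rewrite adj_cycle_graph; last lia.
move/(cycle_nthP x0): cs => cs.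
case/orP=> /eqP-> /=; first exact: cs.
by rewrite adjC; apply: cs.
Qed.

(** A long cycle of [G + uv] must use the edge [uv], since [G] has none; without that edge it is a
    path from [u] to [v]. *)
Lemma saturated_cycleP r G : 2 < r ->
  saturated (cycles_ge r) G <->
  (forall s, uniq s -> cycle (adj G) s -> size s < r) /\
  (forall u v, u != v -> ~~ adj G u v ->
     exists2 p, upath (adj G) u v p & r <= (size p).+1).
Proof.
move=> r3; rewrite /saturated contains_cycleP //; split.
  case=> nc sG.
  have short s : uniq s -> cycle (adj G) s -> size s < r.
    by move=> us cs; rewrite ltnNge; apply/negP => rs; apply: nc; exists s.
  split=> // u v uv nuv.
  have [s [us cs rs]] := iffLR (contains_cycleP _ r3) (sG u v uv nuv).
  have nadj : ~~ cycle (adj G) s.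
    by apply/negP => /(short s us); rewrite ltnNge rs.
  (* Some step [y, x] of the cycle is no edge of [G], so it is the new edge; cut there, the cycle
     becomes a path from [x] to [y]. *)
  have [i lis nst] : exists2 i, i < size s &
      ~~ adj G (nth u s i) (nth u s (i.+1 %% size s)).
    apply: contrapT => h; move/negP: nadj; apply.
    apply/(cycle_nthP u) => i lis; apply: contrapT => /negP h'.
    by apply: h; exists i.
  have sz : 0 < size s by apply: leq_ltn_trans lis.
  have lis1 : i.+1 %% size s < size s by rewrite ltn_mod.
  set x := nth u s (i.+1 %% size s) in nst.
  set y := nth u s i in nst.
  have adyx : adj (add_edge G u v) y x.
    by move/(cycle_nthP u): cs; apply.
  pose s' := rot (i.+1 %% size s) s.
  have [p es'] : exists p, s' = x :: p.
    exists (behead s'); rewrite /s' /rot (drop_nth u lis1).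
    by rewrite -/x.
  have us' : uniq (x :: p) by rewrite -es' rot_uniq.
  have cs' : cycle (adj (add_edge G u v)) (x :: p) by rewrite -es' rot_cycle.
  have sp : (size p).+1 = size s.
    by rewrite -[_.+1]/(size (x :: p)) -es' size_rot.
  have ly : last x p = y.
    rewrite -[last x p]/(last x (x :: p)) -es' /s' /rot last_cat.
    have [e|ne] := eqVneq i.+1 (size s).
      rewrite e modnn drop0 take0 /= (last_nth u) /=.
      by rewrite -e.
    have lt : i.+1 < size s by rewrite ltn_neqAle ne.
    by rewrite modn_small // (take_nth u) // last_rcons.
  have pp : path (adj (add_edge G u v)) x p.
    by move: cs' => /=; rewrite rcons_path => /andP[].
  clearbody x y; clear i lis nadj lis1 s' es' cs' cs us.
  (* The new edge does not occur again: its ends are the first and last vertices of the path, which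
     are not consecutive as [r > 2]. *)
  have pG : path (adj G) x p.
    apply/(pathP u) => j jp; have := pathP u pp j jp.
    rewrite adj_add_edge // => /orP[//|h].
    have : ((nth u (x :: p) j == x) && (nth u p j == y)) ||
           ((nth u (x :: p) j == y) && (nth u p j == x)).
      move: adyx; rewrite adj_add_edge // (negbTE nst) /=.
      by case/orP: h => /andP[/eqP-> /eqP->] /orP[] /andP[/eqP-> /eqP->];
        rewrite !eqxx ?orbT.
    have ey : y = nth u (x :: p) (size p) by rewrite -ly (last_nth u).
    have nu k l : k < (size p).+1 -> l < (size p).+1 ->
        nth u (x :: p) k = nth u (x :: p) l -> k = l.
      move=> hk hl eqn; apply/eqP.
      by have := nth_uniq u (s := x :: p) hk hl us'; rewrite eqn eqxx => <-.
    case/orP => /andP[/eqP h1 /eqP h2].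
      have j0 : j = 0 by apply: nu; rewrite // ltnS ltnW.
      have : j.+1 = size p by apply: nu; rewrite // -?ey // ltnS.
      by move=> e1; move: (leq_trans r3 rs); rewrite -sp -e1 j0.
    have : j = size p by apply: nu; rewrite ?h1 ?ey // ltnS ltnW.
    by move=> ej; rewrite ej ltnn in jp.
  have up : upath (adj G) x y p by rewrite /upath pG ly eqxx.
  move: adyx; rewrite adj_add_edge // (negbTE nst) /=.
  case/orP => /andP[/eqP yu /eqP xv].
    rewrite yu xv in up.
    have [q [uq sq _]] := upath_rev (@adjC _ G) up.
    by exists q; rewrite // sq sp.
  by rewrite yu xv in up; exists p => //; lia.
case=> short long; split.
  by case=> s [us cs rs]; have := short s us cs; rewrite ltnNge rs.
move=> u v uv nuv; have [p up rp] := long u v uv nuv.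
apply/contains_cycleP => //; case/and3P: up => pp /eqP lp up.
exists (u :: p); split=> //=; rewrite rcons_path lp.
rewrite [adj _ v u]adj_add_edge // !eqxx !orbT andbT.
by apply: sub_path pp => a b ab; rewrite adj_add_edge // ab.
Qed.

End Saturation.

Section SatUpper.

Variables (T : eqType) (e : rel T) (vs : seq T) (el : seq (T * T)) (r : nat).

(** Lets graphs be built from lists over any [eqType]; the index in [vs] carries them to ['I_n]. As
    its length is only an upper bound, [el] has to cover each edge in one of its two orientations,
    possibly with repetitions. *)
Lemma sat_leq : 2 < r -> symmetric e -> irreflexive e -> uniq vs ->
  (forall u v, u \in vs -> v \in vs -> e u v -> (u, v) \in el \/ (v, u) \in el) ->
  (forall s, uniq s -> all (mem vs) s -> cycle e s -> size s < r) ->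
  (forall u v, u \in vs -> v \in vs -> u != v -> ~~ e u v ->
     exists p, [/\ upath e u v p, all (mem vs) p & r <= (size p).+1]) ->
  sat (size vs) (cycles_ge r) <= size el.
Proof.
move=> r3 sym irr uvs cov short long.
case: (posnP (size vs)) => [s0|vs0].
  have [[G _ <-] _] := sat_min (saturated_cycles_ge_ex (size vs) r3).
  apply: leq_trans (card_edges G) _.
  by rewrite card_ord bin_small // s0.
have [x0 _] : exists x0 : T, true by case: (vs) vs0 => // x; exists x.
set n := size vs in vs0 *.
pose h (i : 'I_n) := nth x0 vs i.
have hi : injective h.
  by move=> i j /eqP; rewrite nth_uniq // => /eqP /val_inj.
have hvs i : h i \in vs by apply: mem_nth.
pose k x : 'I_n := insubd (Ordinal vs0) (index x vs).
have hK : cancel h k.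
  move=> i; apply: val_inj; rewrite val_insubd index_uniq // ltn_ord.
  by [].
have kK x : x \in vs -> h (k x) = x.
  move=> xv; rewrite /h val_insubd -index_mem in xv *; rewrite xv nth_index //.
  by rewrite -index_mem.
pose E' := [set [set p.1; p.2] | p : 'I_n * 'I_n & e (h p.1) (h p.2)].
have adjE i j : adj (mkgraph E') i j = e (h i) (h j).
  rewrite adj_mkgraph; apply/andP/idP => [[/imsetP[[a b] /=]]|ij].
    rewrite inE /= => ab /eqP; rewrite set2_eq.
    by case/orP=> /andP[/eqP-> /eqP->] _ //; rewrite sym.
  split; first by apply/imsetP; exists (i, j); rewrite ?inE.
  by apply: contraTneq ij => ->; rewrite irr.
have le : #|edges (mkgraph E')| <= size el.
  apply: leq_trans (subset_leq_card (subsetIl _ _)) _.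
  apply: leq_trans (_ : #|[set f in [seq [set k x.1; k x.2] | x <- el]]| <= _).
    apply/subset_leq_card/subsetP => f /imsetP[[a b]]; rewrite inE /= => ab ->.
    rewrite inE; apply/mapP.
    have [?|?] := cov _ _ (hvs a) (hvs b) ab.
      by exists (h a, h b); rewrite //= !hK.
    by exists (h b, h a); rewrite //= !hK setUC.
  by rewrite cardsE; apply: leq_trans (card_size _) _; rewrite size_map.
apply: leq_trans le.
have [_ mn] := sat_min (saturated_cycles_ge_ex n r3).
apply: mn; apply/saturated_cycleP => //; split.
  move=> s us cs; rewrite -(size_map h); apply: short.
  - by rewrite map_inj_uniq.
  - by apply/allP => x /mapP[i _ ->]; apply: hvs.
  - by rewrite cycle_map; apply: sub_cycle cs => i j; rewrite adjE.
move=> u v uv; rewrite adjE => nuv.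
have huv : h u != h v by rewrite (inj_eq hi).
have [p [/and3P[pp /eqP lp up] pv rp]] := long _ _ (hvs u) (hvs v) huv nuv.
have ep : p = map h (map k p).
  rewrite -map_comp map_id_in // => x xp.
  by rewrite /= kK //; apply: (allP pv).
exists (map k p); last by rewrite size_map.
rewrite ep in pp lp up.
rewrite /upath; apply/and3P; split.
- by move: pp; rewrite path_map; apply: sub_path => i j; rewrite adjE.
- by rewrite -(inj_eq hi) -last_map lp.
- by move: up; rewrite -map_cons map_inj_uniq.
Qed.

End SatUpper.

(** * The lower bound *)

Section InducedDegrees.

Variables (V : finType) (G : sgraph V).
Implicit Types (S A : {set V}) (u v w : V).

Definition nbrs S v := [set w in S | adj G v w].
Definition edges_in S := [set f in edges G | f \subset S].

Lemma nbrsP S v w : (w \in nbrs S v) = (w \in S) && adj G v w.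
Proof. by rewrite inE. Qed.

Lemma sum_degree S : \sum_(v in S) #|nbrs S v| = #|edges_in S| * 2.
Proof.
have deg v : v \in S -> #|nbrs S v| = \sum_(f in edges_in S) (v \in f : nat).
  move=> vS; rewrite -big_mkcondr /= sum1dep_card.
  rewrite -(card_in_imset (f := fun w => [set v; w]) (D := nbrs S v)).
    apply: eq_card => f; rewrite [RHS]inE; apply/imsetP/andP => [[w]|].
      rewrite nbrsP => /andP[wS vw] ->.
      rewrite set21 inE subUset !sub1set vS wS !andbT; split=> //; exact: vw.
    rewrite inE => -[/andP[fE fS] vf].
    have : #|f| == 2 by have := subsetP (edges_pairs G) f fE; rewrite inE.
    case/cards2P=> x [y [xy ef]]; subst f.
    move: vf fS; rewrite subUset !sub1set -/(adj G x y) in fE *.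
    case/set2P=> e /andP[xS yS]; subst v.
      by exists y => //; rewrite nbrsP yS.
    by exists x; rewrite 1?setUC // nbrsP xS adjC.
  move=> w w'; rewrite !nbrsP => /andP[_ /adj_neq vw] /andP[_ /adj_neq vw'].
  move/setP/(_ w); rewrite !inE eqxx orbT eq_sym (negbTE vw) /=.
  by move/esym/eqP.
rewrite (eq_bigr _ deg) exchange_big /=.
rewrite (eq_bigr (fun=> 2)) ?sum_nat_const // => f.
rewrite inE => /andP[fE fS].
rewrite -big_mkcondr /= sum1dep_card.
have /eqP <- : #|f| == 2 by have := subsetP (edges_pairs G) f fE; rewrite inE.
apply: eq_card => x; rewrite inE; apply/andP/idP => [[] //|xf].
by rewrite (subsetP fS).
Qed.

Lemma clique_edges S : (forall u v, u \in S -> v \in S -> u != v -> adj G u v) ->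
  #|edges_in S| * 2 = #|S| * (#|S|).-1.
Proof.
move=> cl; rewrite -sum_degree -sum_nat_const; apply: eq_bigr => v vS.
rewrite (cardsD1 v S) vS; apply: eq_card => w; rewrite nbrsP !inE andbC.
apply/andP/andP => -[h wS]; split=> //; first by rewrite eq_sym (adj_neq h).
by apply: cl; rewrite // eq_sym.
Qed.

Lemma edges_in_mono A S : A \subset S -> #|edges_in A| <= #|edges_in S|.
Proof.
move=> AS; apply/subset_leq_card/subsetP => f; rewrite !inE => /andP[-> fA].
exact: subset_trans fA AS.
Qed.

Lemma path_leaves u p S : path (adj G) u p -> u \in S -> last u p \notin S ->
  exists x y, [/\ x \in S, y \notin S, adj G x y & x \in u :: p].
Proof.
elim: p u => [|w p IH] u /=; first by move=> _ ->.
case/andP=> uw pp uS lS; have [wS|wS] := boolP (w \in S).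
  have [x [y [xS yS xy xp]]] := IH w pp wS lS.
  by exists x, y; split=> //; rewrite inE xp orbT.
by exists u, w; split=> //; rewrite inE eqxx.
Qed.

(** By connectivity some edge leaves [S] as long as a vertex is missing; adding its outer end gains
    one vertex and at least one edge. *)
Lemma edges_in_grow S : S != set0 ->
  (forall u v, exists2 p, path (adj G) u p & last u p = v) ->
  #|edges_in S| + #|V| <= #|edges G| + #|S|.
Proof.
move=> S0 conn; have [m mS] := ubnP #|~: S|; elim: m S S0 mS => // m IH S S0 mS.
have [c0|/set0Pn[w wS]] := eqVneq (~: S) set0.
  have -> : S = setT by rewrite -[S]setCK c0 setC0.
  rewrite cardsT leq_add2r; apply/subset_leq_card/subsetP => f.
  by rewrite inE => /andP[].
have /set0Pn[u uS] := S0; rewrite inE in wS.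
have [p pp lp] := conn u w; rewrite -lp in wS.
have [x [y [xS yS xy _]]] := path_leaves pp uS wS.
have c1 : #|y |: S| = #|S|.+1 by rewrite cardsU1 yS.
have e1 : #|edges_in S| < #|edges_in (y |: S)|.
  apply: proper_card; apply/properP; split.
    apply/subsetP => f; rewrite !inE => /andP[-> fS] /=.
    exact: subset_trans fS (subsetU1 _ _).
  exists [set x; y]; rewrite !inE.
    by rewrite -/(adj G x y) xy subUset !sub1set !inE xS eqxx orbT.
  by rewrite subUset !sub1set (negbTE yS) !andbF.
have := IH (y |: S); rewrite c1.
have -> : (y |: S != set0) by apply/set0Pn; exists y; rewrite !inE eqxx.
have : #|~: (y |: S)| < m.
  have := cardsC S; have := cardsC (y |: S); lia.
move=> h /(_ isT h); lia.
Qed.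

End InducedDegrees.

Lemma leq_absurd m n k : m < n -> n <= k -> k <= m -> False.
Proof. lia. Qed.

Section LowerBound.

Variables (V : finType) (G : sgraph V) (r : nat).
Hypothesis r28 : 28 <= r.
Hypothesis short : forall s, uniq s -> cycle (adj G) s -> size s < r.

Definition long_paths (S : {set V}) := forall u v,
  u \in S -> v \in S -> u != v -> ~~ adj G u v ->
  exists p, [/\ upath (adj G) u v p, all (mem S) p & r <= (size p).+1].

(** A path between vertices outside [A] that visits [A] would have to pass through the cut vertex
    [c] both on entering and on leaving. *)
Lemma long_pathsD (S A : {set V}) c : long_paths S ->
  (forall x y, x \in A -> y \in S -> adj G x y -> y \in c |: A) ->
  c \notin A -> long_paths (S :\: A).
Proof.
move=> lS sepA cA u v; rewrite !inE => /andP[uA uS] /andP[vA vS] uv nuv.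
have [p [up pS rp]] := lS u v uS vS uv nuv.
exists p; split=> //.
suff: all (fun x => x \notin A) p.
  by move=> h; apply/allP => x xp; rewrite !inE (allP h) //=; apply: (allP pS).
apply/negPn/negP => /allPn[a ap]; rewrite negbK => aA.
case/splitPr: ap up pS => p1 p2 /and3P[pp lp up] pS.
move: pp; rewrite cat_path /= => /and3P[pp1 pa pp2].
move: lp; rewrite last_cat /= => /eqP lp.
have c1 : c \in u :: p1.
  have path1 : path (adj G) u (rcons p1 a) by rewrite rcons_path pp1.
  have [||x [y [xA yA xy xp]]] := path_leaves (S := ~: A) path1 _ _.
  - by rewrite inE.
  - by rewrite last_rcons inE aA.
  move: xA yA; rewrite !inE negbK => xA yA.
  have xS : x \in S.
    move: xp; rewrite -rcons_cons mem_rcons !inE => /or3P[/eqP ex|/eqP->//|xp].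
      by rewrite ex aA in xA.
    by apply: (allP pS); rewrite mem_cat xp.
  have : x \in c |: A by apply: (sepA y) => //; rewrite adjC.
  rewrite !inE (negbTE xA) orbF => /eqP ex.
  move: xp; rewrite -rcons_cons mem_rcons inE ex => /orP[/eqP ec|//].
  by rewrite ec aA in cA.
have c2 : c \in p2.
  have yp : exists y, [/\ y \in p2, y \notin A & exists2 x, x \in A & adj G x y].
    elim: (p2) (a) aA pp2 lp => [|b l IH] a' a'A /=.
      by move=> _ e; rewrite e (negbTE vA) in a'A.
    case/andP=> ab pl ll; have [bA|bA] := boolP (b \in A).
      have [y' [h1 h2 h3]] := IH b bA pl ll.
      by exists y'; rewrite inE h1 orbT.
    by exists b; rewrite inE eqxx; split=> //; exists a'.
  have [y' [y'p y'A [x' x'A x'y]]] := yp.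
  have : y' \in c |: A.
    by apply: (sepA x') => //; apply: (allP pS); rewrite mem_cat inE y'p !orbT.
  by rewrite !inE (negbTE y'A) orbF => /eqP <-.
move: up; rewrite -cat_cons cat_uniq => /and3P[_ /hasPn/(_ c) h _].
by move: h; rewrite inE c2 orbT => /(_ isT); rewrite c1.
Qed.

(** With fewer than [r] vertices there is no room for the path that a nonadjacent pair requires. *)
Lemma long_paths_clique S : long_paths S -> #|S| < r ->
  forall u v, u \in S -> v \in S -> u != v -> adj G u v.
Proof.
move=> lS Sr u v uS vS uv; apply: contrapT => /negP nuv.
have [p [/and3P[_ _ up] pS rp]] := lS u v uS vS uv nuv.
have : size (u :: p) <= #|S|.
  rewrite -(card_uniqP up); apply/subset_leq_card/subsetP => x.
  by rewrite inE => /orP[/eqP->//|/(allP pS)].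
by rewrite leqNgt (leq_trans Sr rp).
Qed.

Section Minimal.

Variable S : {set V}.
Hypothesis rS : r <= #|S|.
Hypothesis lS : long_paths S.
Hypothesis minS : forall S' : {set V}, r <= #|S'| -> long_paths S' -> #|S| <= #|S'|.

Local Notation N := (nbrs G S).
Local Notation deg v := #|N v|.

Hypothesis few : #|edges_in G S| * 2 < #|S| * 2 + r.

(** Deleting [A] preserves [long_paths]. If [r] vertices remain, this contradicts minimality;
    otherwise what remains is a clique on at least [r - 4] vertices, with more edges than [few]
    allows. *)
Lemma no_small_cut (A : {set V}) c : A \subset S -> 0 < #|A| <= 4 ->
  (forall x y, x \in A -> y \in S -> adj G x y -> y \in c |: A) ->
  c \notin A -> False.
Proof.
move=> AS /andP[A0 A4] sepA cA.
have l1 := long_pathsD lS sepA cA.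
have cS : #|S :\: A| + #|A| = #|S|.
  by have := cardsID A S; rewrite (setIidPr AS); lia.
have [r1|r1] := leqP r #|S :\: A|.
  have := minS r1 l1; lia.
have cl := clique_edges (long_paths_clique l1 r1).
have em := edges_in_mono G (subsetDl S A).
nia.
Qed.

Lemma deg_ge2 v : v \in S -> 2 <= deg v.
Proof.
move=> vS; have [w wS wv] : exists2 w, w \in S & w != v.
  have : 0 < #|S :\ v| by have := cardsD1 v S; rewrite vS; lia.
  by case/card_gt0P=> w; rewrite !inE => /andP[wv wS]; exists w.
have d0 : 0 < deg v.
  apply/card_gt0P; have [vw|nvw] := boolP (adj G v w).
    by exists w; rewrite nbrsP wS.
  rewrite eq_sym in wv.
  have [[|x p] [up pS rp]] := lS vS wS wv nvw; first by move: rp => /=; lia.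
  exists x; rewrite nbrsP; case/and3P: up => /= /andP[-> _] _ _.
  by move: pS => /= /andP[->].
have [//|d1] := leqP 2 (deg v).
have /cards1P[c Nc] : #|N v| == 1 by apply/eqP; lia.
have cN : c \in N v by rewrite Nc inE.
exfalso; apply: (@no_small_cut [set v] c); rewrite ?sub1set ?cards1 //.
  move=> x y; rewrite !inE => /eqP-> yS vy.
  by have : y \in N v; [rewrite nbrsP yS | rewrite Nc inE => ->].
rewrite inE; apply: contraL cN => /eqP->; by rewrite nbrsP adj_irr andbF.
Qed.

Lemma nbrs2P v a b : N v = [set a; b] ->
  [/\ a \in S, b \in S, adj G v a, adj G v b &
      forall y, y \in S -> adj G v y -> y = a \/ y = b].
Proof.
move=> Nv; have aN : a \in N v by rewrite Nv set21.
have bN : b \in N v by rewrite Nv set22.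
move: aN bN; rewrite !nbrsP => /andP[aS va] /andP[bS vb]; split=> // y yS vy.
by have : y \in N v; [rewrite nbrsP yS | rewrite Nv => /set2P].
Qed.

Lemma uniq_last_nil (x : V) p : uniq (x :: p) -> last x p = x -> p = [::].
Proof. by case: p => //= y p /andP[+ _] e; rewrite -{1}e mem_last. Qed.

(* Rerouting a long cycle through [v] instead of an edge between its          *)
(* neighbours would lengthen it.                                              *)
Lemma deg2_triangle v a b : v \in S -> a != b -> N v = [set a; b] -> adj G a b.
Proof.
move=> vS ab Nv; have [aS bS va vb Nv'] := nbrs2P Nv.
apply: contrapT => /negP nab.
have [p [up pS rp]] := lS aS bS ab nab.
case/and3P: (up) => pp /eqP lp uap.
(* A path from [a] to [b] through [v] can only be [a, v, b], which is too short; one avoiding [v] is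
   closed by [v] to a cycle that is too long. *)
have [vp|vp] := boolP (v \in p).
  case/splitPr: vp pp lp uap pS rp {up} => p1 p2.
  rewrite cat_path last_cat -cat_cons cat_uniq /=.
  case/and3P=> pp1 pv pp2 lp /and3P[/andP[ap1 up1] dis /andP[vp2 up2]].
  rewrite all_cat /= => /and3P[p1S _ p2S]; rewrite size_cat /=.
  case: p2 pp2 lp dis vp2 up2 p2S => [|y p2] /=.
    by move=> _ vb'; rewrite vb' adj_irr in vb.
  case/andP=> vy pp2 lp; rewrite !negb_or => /and3P[_ + dis].
  move=> /andP[ya yp1] _ /andP[yp2 up2] /andP[yS _].
  have {}yp1 : y \notin p1 := yp1.
  have [ey|ey] := Nv' y yS vy; first by rewrite ey eqxx in ya.
  rewrite ey in lp yp1 yp2.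
  have -> : p2 = [::] by apply: (@uniq_last_nil b) => //=; rewrite yp2.
  have p1e : p1 = [::].
    apply: (@uniq_last_nil a); first by rewrite /= ap1.
    have lS1 : last a p1 \in S.
      by have := mem_last a p1; rewrite inE => /orP[/eqP->//|/(allP p1S)].
    have [//|e] := Nv' _ lS1 (etrans (adjC _ _ _) pv).
    have := mem_last a p1; rewrite e inE (negbTE yp1) orbF => /eqP eb.
    by rewrite eb eqxx in ab.
  by rewrite p1e /= => /(leq_trans r28).
have : size (v :: a :: p) < r.
  apply: short; first by rewrite cons_uniq uap inE negb_or vp andbT (adj_neq va).
  by rewrite /cycle rcons_path /= va pp lp adjC vb.
by move=> sz; apply: (leq_absurd sz rp) => /=.
Qed.

(** If [a] had degree 2, then [b] would cut off [v] and [a]. If its only other neighbour were [x], a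
    long path from [v] to [x] could be rerouted through [v] and [a] and closed by the edge [x a] to
    a cycle of length at least [r]. *)
Lemma deg2_nbr_ge4 v a b : v \in S -> a != b -> N v = [set a; b] -> 4 <= deg a.
Proof.
move=> vS ab Nv; have [aS bS va vb Nv'] := nbrs2P Nv.
have adjab := deg2_triangle vS ab Nv.
have vb' := adj_neq vb; have va' := adj_neq va.
have vN : v \in N a by rewrite nbrsP vS adjC.
have bN : b \in N a by rewrite nbrsP bS.
have d2 : #|N a :\ v :\ b| + 2 = deg a.
  have := cardsD1 v (N a); have := cardsD1 b (N a :\ v).
  by rewrite vN in_setD1 bN eq_sym vb' => e1 e2; rewrite [RHS]e2 e1 addn2.
have [//|d4] := leqP 4 (deg a); exfalso.
have [d3|d3] := posnP #|N a :\ v :\ b|.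
  apply: (@no_small_cut [set v; a] b).
  - by rewrite subUset !sub1set vS.
  - by rewrite cards2; case: (_ != _).
  - move=> x y /set2P[->|->] yS xy.
      by have [->|->] := Nv' y yS xy; rewrite !inE eqxx ?orbT.
    have : y \notin N a :\ v :\ b by rewrite (cards0_eq d3) inE.
    rewrite !inE yS xy !andbT negb_and !negbK.
    by case/orP=> ->; rewrite ?orbT.
  - by rewrite !inE negb_or eq_sym vb' eq_sym ab.
have /cards1P[x Nx] : #|N a :\ v :\ b| == 1.
  by rewrite eqn_leq d3 andbT -(leq_add2r 2) d2 -ltnS.
have Na y : y \in S -> adj G a y -> [\/ y = v, y = b | y = x].
  move=> yS ay; have [->|yv] := eqVneq y v; first by constructor 1.
  have [->|yb] := eqVneq y b; first by constructor 2.
  constructor 3; apply/set1P; rewrite -Nx !inE yb yv yS; exact: ay.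
have : x \in N a :\ v :\ b by rewrite Nx inE.
rewrite !inE => /and4P[xb xv xS ax].
have vx : ~~ adj G v x.
  apply/negP => /(Nv' x xS)[e|e]; last by rewrite e eqxx in xb.
  by rewrite e adj_irr in ax.
have xv' : v != x by rewrite eq_sym.
have [p [/and3P[pp /eqP lp up] pS rp]] := lS vS xS xv' vx.
case: p pp lp up pS rp => [|y p] /=.
  by move=> _ _ _ _ /(leq_trans r28).
case/andP=> vy pp lp /andP[vyp uyp] /andP[yS pS] rp.
have [ey|ey] := Nv' y yS vy; subst y.
  case: p pp lp vyp uyp pS rp => [|y p] /=.
    by move=> _ _ _ _ _ /(leq_trans r28).
  case/andP=> ay pp lp; rewrite !negb_or => /and3P[_ vy' vp].
  move=> /andP[/andP[ay' ap] /andP[yp uyp]] /andP[yS' pS] rp.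
  have {}vp : v \notin p := vp; have {}ap : a \notin p := ap.
  have [e|e|e] := Na y yS' ay; subst y; first by rewrite eqxx in vy'.
    have : size (a :: v :: b :: p) < r.
      apply: short.
        rewrite !cons_uniq !inE !negb_or ap vp yp uyp vb' ab !andbT.
        by rewrite eq_sym va'.
      by rewrite /cycle rcons_path /= lp pp vb (adjC G a v) va (adjC G x a) ax.
    by move=> sz; apply: (leq_absurd sz rp) => /=.
  have pe : p = [::] by apply: (@uniq_last_nil x) => //=; rewrite yp.
  by rewrite pe /= in rp; move: (leq_trans r28 rp).
(* The path starts with [v, b]. If it avoids [a], then [a] closes it to a cycle. Otherwise the
   neighbours of [a] on it are [b] and [x], and the path is just [v, b, a, x]. *)
have [ap|ap] := boolP (a \in p); last first.
  have : size (a :: v :: b :: p) < r.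
    apply: short.
      rewrite cons_uniq !inE !negb_or ap ab eq_sym va' /=.
      by rewrite vyp.
    by rewrite /cycle rcons_path /= lp pp vb (adjC G a v) va (adjC G x a) ax.
  by move=> sz; apply: (leq_absurd sz rp) => /=.
case/splitPr: ap pp lp vyp uyp pS rp => p1 p2.
rewrite cat_path last_cat /= => /and3P[pp1 pa pp2] lp.
rewrite inE negb_or mem_cat negb_or inE negb_or => /and4P[_ vp1 _ vp2].
rewrite -[(b \notin _) && _]/(uniq (b :: p1 ++ a :: p2)) -cat_cons cat_uniq.
case/and3P=> /andP[bp1 up1] dis /andP[ap2 up2].
rewrite all_cat => /andP[p1S /= /andP[_ p2S]]; rewrite size_cat /= => rp.
case: p2 pp2 lp dis ap2 up2 p2S vp2 rp => [|y p2] /=.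
  by move=> _ e; rewrite e adj_irr in ax.
case/andP=> ay pp2 lp; rewrite !negb_or => /and3P[_ yp1 dis] _.
case/andP=> yp2 up2 /andP[yS' p2S] /andP[vy' vp2] rp.
have {}yp1 : y \notin b :: p1 by rewrite inE negb_or.
have lS1 : last b p1 \in S.
  by have := mem_last b p1; rewrite inE => /orP[/eqP->//|/(allP p1S)].
have xl : x \in y :: p2 by rewrite -lp mem_last.
have p1e : p1 = [::].
  apply: (@uniq_last_nil b); first by rewrite /= bp1.
  have [e|//|e] := Na _ lS1 (etrans (adjC _ _ _) pa).
    have := mem_last b p1; rewrite e inE (negbTE vp1) orbF => /eqP eb.
    by rewrite eb eqxx in vb'.
  have := mem_last b p1; rewrite e => xb1.
  move: xl; rewrite inE => /orP[/eqP exy|xp2].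
    by rewrite -exy xb1 in yp1.
  by move/hasPn: dis => /(_ x xp2); rewrite xb1.
have [e|e|e] := Na y yS' ay.
- by rewrite e eqxx in vy'.
- by rewrite e inE eqxx in yp1.
- rewrite e in lp yp2; have p2e : p2 = [::].
    by apply: (@uniq_last_nil x) => //=; rewrite yp2.
  by rewrite p1e p2e /= in rp; move: (leq_trans r28 rp).
Qed.

Definition deg2_nbrs a := [set v in N a | deg v == 2].

(** This says that [a] keeps charge 3 after giving 1/2 to each neighbour of degree 2. If there is
    such a neighbour, then [a] has degree at least 4 and a further neighbour [b] of degree at least
    4. The bound then fails only for degree 4 with three neighbours of degree 2; these are all
    adjacent to [b], which cuts them off together with [a]. Hence the 4 in [no_small_cut]. *)
Lemma deg2_nbrs_few a : a \in S -> 3 <= deg a ->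
  #|deg2_nbrs a| + 6 <= 2 * deg a.
Proof.
move=> aS d3; have [->|t0] := posnP #|deg2_nbrs a|; first lia.
have other v : v \in deg2_nbrs a ->
    exists b, [/\ N v = [set a; b], b \in N a & 4 <= deg b] /\ v \in S.
  rewrite in_set nbrsP => /andP[/andP[vS av] /cards2P[x [y [xy Nv]]]].
  have aN : a \in N v by rewrite nbrsP aS adjC.
  have [b Nb ab] : exists2 b, N v = [set a; b] & a != b.
    move: aN; rewrite Nv => /set2P[e|e]; first by exists y; rewrite ?e.
    by exists x; rewrite e ?(setUC [set x]) // eq_sym.
  exists b; split=> //; split=> //.
    by rewrite nbrsP (deg2_triangle vS ab Nb) andbT; case: (nbrs2P Nb).
  have ba : b != a by rewrite eq_sym.
  by apply: (deg2_nbr_ge4 vS ba); rewrite setUC.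
case/card_gt0P: t0 => v v2; have [b [[Nv bN d4b] vS]] := other v v2.
have ab : a != b.
  by apply: contraTneq bN => <-; rewrite nbrsP adj_irr andbF.
have d4 := deg2_nbr_ge4 vS ab Nv.
have b2 : b \notin deg2_nbrs a by rewrite in_set bN /=; lia.
have sub : deg2_nbrs a \subset N a :\ b.
  apply/subsetP => x x2; rewrite in_setD1; apply/andP; split.
    by apply: contraNneq b2 => <-.
  by move: x2; rewrite in_set => /andP[].
have cb : #|N a :\ b| + 1 = deg a by rewrite [RHS](cardsD1 b) bN; lia.
have := subset_leq_card sub.
have [d5|d5] := leqP 5 (deg a); first lia.
have [t2|t3] := leqP #|deg2_nbrs a| 2; first lia.
move=> t3'; exfalso.
have eqN : deg2_nbrs a = N a :\ b.
  by apply/eqP; rewrite eqEcard sub /=; lia.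
apply: (@no_small_cut (a |: deg2_nbrs a) b).
- rewrite subUset sub1set aS; apply/subsetP => x.
  by rewrite in_set nbrsP => /andP[/andP[]].
- by rewrite cardsU1; case: (_ \notin _); lia.
- move=> x y; rewrite in_setU1 => /orP[/eqP->|x2] yS xy.
    have yN : y \in N a by rewrite nbrsP yS.
    by rewrite eqN !in_setU1 in_setD1 yN; case: (y == b); rewrite //= orbT.
  have [c [[Nx cN d4c] xS]] := other x x2.
  have : y \in N x by rewrite nbrsP yS.
  rewrite Nx => /set2P[->|->]; first by rewrite !in_setU1 eqxx orbT.
  suff -> : c = b by rewrite in_setU1 eqxx.
  apply: contraTeq d4c => cb'.
  have : c \in deg2_nbrs a by rewrite eqN in_setD1 cb'.
  by rewrite in_set => /andP[_ /eqP->].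
- rewrite in_setU1 negb_or b2 andbT eq_sym; exact: ab.
Qed.

(* Each vertex of degree 2 takes 1/2 from both of its neighbours. *)
Lemma avg_degree : 3 * #|S| <= \sum_(v in S) deg v.
Proof.
pose D2 := [set v in S | deg v == 2]; pose D3 := [set v in S | 2 < deg v].
have split (F : V -> nat) :
    \sum_(v in S) F v = \sum_(v in D2) F v + \sum_(v in D3) F v.
  rewrite (bigID (fun v => deg v == 2)) /=; congr (_ + _).
    by apply: eq_bigl => v; rewrite in_set.
  apply: eq_bigl => v; rewrite in_set; have [vS|//] := boolP (v \in S).
  by have := deg_ge2 vS; rewrite leq_eqVlt eq_sym /=; case: eqP => //= ->.
have s2 : \sum_(v in D2) deg v = #|D2| * 2.
  by rewrite -sum_nat_const; apply: eq_bigr => v; rewrite in_set => /andP[_ /eqP].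
have cS : #|S| = #|D2| + #|D3| by rewrite -!sum1_card split.
have key : \sum_(a in D3) #|deg2_nbrs a| = #|D2| * 2.
  rewrite -s2.
  have -> : \sum_(v in D2) deg v = \sum_(v in D2) \sum_(a in D3) (adj G a v : nat).
    apply: eq_bigr => v; rewrite in_set => /andP[vS dv].
    rewrite -big_mkcondr sum1dep_card; apply: eq_card => a.
    rewrite nbrsP in_set [a \in D3]in_set adjC.
    apply/andP/andP => [[aS av]|[/andP[aS _] av]] //.
    rewrite aS; split=> //=; case/cards2P: (dv) => x [y [xy Nv]].
    have : a \in N v by rewrite nbrsP aS adjC.
    rewrite Nv => /set2P[->|->].
      exact: ltnW (deg2_nbr_ge4 vS xy Nv).
    rewrite setUC in Nv; rewrite eq_sym in xy.
    exact: ltnW (deg2_nbr_ge4 vS xy Nv).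
  rewrite exchange_big /=; apply: eq_bigr => a _.
  rewrite -big_mkcondr sum1dep_card; apply: eq_card => v.
  by rewrite !in_set andbAC.
have le : \sum_(a in D3) (#|deg2_nbrs a| + 6) <= \sum_(a in D3) (2 * deg a).
  by apply: leq_sum => a; rewrite in_set => /andP[aS d3]; apply: deg2_nbrs_few.
move: le; rewrite big_split /= key sum_nat_const -big_distrr /= split s2 cS.
lia.
Qed.

End Minimal.

(** Take a smallest [S] with [long_paths]. With too few edges its average degree would still be at
    least 3, and [3|S| >= 2|S| + r], a contradiction. *)
Lemma saturated_edges : r <= #|V| -> long_paths setT ->
  #|V| + uphalf r <= #|edges G|.
Proof.
move=> rV lT.
pose P (S : {set V}) := (r <= #|S|) && `[< long_paths S >].
have PT : P setT by rewrite /P cardsT rV; apply/asboolP.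
case: (@arg_minnP _ setT P (fun S : {set V} => #|S|) PT) => S /andP[rS /asboolP lS] mS.
have minS (S' : {set V}) : r <= #|S'| -> long_paths S' -> #|S| <= #|S'|.
  by move=> rS' lS'; apply: mS; rewrite /P rS'; apply/asboolP.
have e2 : #|S| * 2 + r <= #|edges_in G S| * 2.
  rewrite leqNgt; apply/negP => few.
  have := avg_degree rS lS minS few.
  by rewrite sum_degree; lia.
have := @edges_in_grow _ G S.
have -> : S != set0 by rewrite -card_gt0; lia.
move=> /(_ isT) h.
have {}h := h _; have : #|edges_in G S| + #|V| <= #|edges G| + #|S|.
  apply: h => u v; have [->|uv] := eqVneq u v; first by exists [::].
  have [a|na] := boolP (adj G u v); first by exists [:: v]; rewrite /= ?a.
  have [p [/and3P[pp /eqP lp _] _ _]] := lT u v (in_setT _) (in_setT _) uv na.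
  by exists p.
lia.
Qed.

End LowerBound.

Lemma sat_geq n r : 28 <= r <= n -> n + uphalf r <= sat n (cycles_ge r).
Proof.
case/andP=> r28 rn; have r3 : 2 < r by lia.
have [[G sG <-] _] := sat_min (saturated_cycles_ge_ex n r3).
have [short long] := iffLR (saturated_cycleP G r3) sG.
have := @saturated_edges _ G r r28 short; rewrite card_ord; apply=> //.
move=> u v _ _ uv nuv; have [p up rp] := long u v uv nuv.
by exists p; split=> //; apply/allP => x _; rewrite inE.
Qed.

(** * Calculating with linkages *)

(** Each pair holds the labels of the two ends of one path. Labels are tied to vertices only by
    [realizes], so the calculation is independent of the graph. *)
Definition linkage := seq (nat * nat).

Fixpoint pick_end (l : nat) (ps : linkage) : option (nat * linkage) :=
  if ps is p :: ps' then
    if p.1 == l then Some (p.2, ps') else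
    if p.2 == l then Some (p.1, ps') else
    if pick_end l ps' is Some c then Some (c.1, p :: c.2) else None
  else None.

(** Adds an edge from [a] to [b]. The piece ending at [a] is removed before [b] is looked up, so the
    two ends of one piece are never joined to a cycle. *)
Definition join (a b : nat) (ps : linkage) : option linkage :=
  if pick_end a ps is Some (x, ps') then
    if pick_end b ps' is Some (y, ps'') then Some ((x, y) :: ps'') else None
  else None.

(** A strand crossing a seam is used on both sides or on neither; a label present on one side only
    is a failure. *)
Definition seam (a b : nat) (ps : linkage) : option linkage :=
  if pick_end a ps is None then
    if pick_end b ps is None then Some ps else None
  else join a b ps.

Definition relabel (f : nat -> nat) (ps : linkage) : linkage :=
  [seq (f p.1, f p.2) | p <- ps].

(** The two ends of a piece must get different labels, since a single vertex may end a piece at two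
    ports but cannot use one port twice. *)
Fixpoint assign (opt : nat -> seq nat) (ps : linkage) : seq linkage :=
  if ps is p :: ps' then
    let qs := assign opt ps' in
    flatten [seq flatten [seq (if a == b then [::] else [seq (a, b) :: q | q <- qs])
                           | b <- opt p.2] | a <- opt p.1]
  else [:: [::]].

Definition orient (p : nat * nat) := if p.1 <= p.2 then p else (p.2, p.1).
Definition piece_le (p q : nat * nat) :=
  (p.1 < q.1) || (p.1 == q.1) && (p.2 <= q.2).
Definition norm (ps : linkage) : linkage := sort piece_le (map orient ps).

Section Realization.

Variables (T : eqType) (e : rel T).
Hypothesis sym_e : symmetric e.
Implicit Types (f g : nat -> T) (ps : linkage) (S : seq T) (q : seq T).

(** Unlike [upath], [q] lists both ends, and distinctness is left to the set that the pieces have to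
    cover. *)
Definition chain x y q :=
  if q is z :: p then [&& z == x, path e z p & last z p == y] else false.

(* [realizes f ps S]: the set [S] splits into disjoint paths, one for each    *)
(* pair of [ps], whose ends are the vertices named by the pair.               *)
Fixpoint realizes f ps S : Prop :=
  if ps is p :: ps' then
    exists q S', [/\ chain (f p.1) (f p.2) q, realizes f ps' S' & perm_eq (q ++ S') S]
  else S = [::].

Lemma chain_rev x y q : chain x y q -> chain y x (rev q).
Proof.
case: q => // z p /and3P[/eqP-> pp /eqP lp]; rewrite /chain.
rewrite lastI lp rev_rcons eqxx /=; apply/andP; split.
  rewrite -lp rev_path; apply: sub_path pp => a b /=; by rewrite sym_e.
by case: p lp {pp} => [/= ->|a l _] //=; rewrite rev_cons last_rcons.
Qed.

Lemma chain_cat x y x' y' q q' :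
  chain x y q -> chain x' y' q' -> e y x' -> chain x y' (q ++ q').
Proof.
case: q => // z p /and3P[/eqP-> pp /eqP lp].
case: q' => // z' p' /and3P[/eqP-> pp' /eqP lp'] exy.
by rewrite /= eqxx cat_path pp last_cat lp /= exy pp' lp' eqxx.
Qed.

Lemma realizes_cat f ps ps' S S' :
  realizes f ps S -> realizes f ps' S' -> realizes f (ps ++ ps') (S ++ S').
Proof.
elim: ps S => [|p ps IH] S /=; first by move=> ->.
case=> q [R [cq rR pR]] r'; exists q, (R ++ S'); split=> //.
  exact: IH.
by rewrite catA perm_cat2r.
Qed.

Lemma realizes_relabel f g ps S (h : nat -> nat) :
  (forall p, p \in ps -> f p.1 = g (h p.1) /\ f p.2 = g (h p.2)) ->
  realizes f ps S -> realizes g (relabel h ps) S.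
Proof.
elim: ps S => [|p ps IH] S //= hp [q [R [cq rR pR]]].
have [<- <-] := hp p (mem_head _ _); exists q, R; split=> //.
by apply: IH rR => p' p'in; apply: hp; rewrite inE p'in orbT.
Qed.

Lemma realizes_eq f g ps S :
  (forall p, p \in ps -> f p.1 = g p.1 /\ f p.2 = g p.2) ->
  realizes f ps S -> realizes g ps S.
Proof.
move=> h /(realizes_relabel (h := id) h); congr realizes.
by rewrite /relabel -[RHS]map_id; apply: eq_map => -[].
Qed.

Lemma realizes_swap f p p' ps S :
  realizes f (p :: p' :: ps) S -> realizes f (p' :: p :: ps) S.
Proof.
case=> q [R [cq [q' [R' [cq' rR' pR']]] pR]].
exists q', (q ++ R'); split=> //.
  by exists q, R'.
by rewrite perm_catCA; apply: perm_trans pR; rewrite perm_cat2l.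
Qed.

Lemma realizes_cons f p ps ps' S :
  (forall S', realizes f ps S' -> realizes f ps' S') ->
  realizes f (p :: ps) S -> realizes f (p :: ps') S.
Proof. by move=> h [q [R [cq rR pR]]]; exists q, R; split=> //; apply: h. Qed.

Lemma realizes_flip f p ps S :
  realizes f (p :: ps) S -> realizes f ((p.2, p.1) :: ps) S.
Proof.
case=> q [R [cq rR pR]]; exists (rev q), R; split=> //; first exact: chain_rev.
apply: perm_trans pR; rewrite perm_cat2r; exact/permEl/perm_rev.
Qed.

Lemma pick_endP f l ps x ps' S :
  pick_end l ps = Some (x, ps') -> realizes f ps S -> realizes f ((l, x) :: ps') S.
Proof.
elim: ps x ps' S => // p ps IH x ps' S /=.
case: eqP => [e1 [<- <-]|_]; first by case: p e1 => p1 p2 /= ->.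
case: eqP => [e2 [<- <-]|_].
  by move=> r; have := @realizes_flip f p ps S r; rewrite e2.
case E: pick_end => [[y r]|] //= -[<- <-] rp.
apply: (@realizes_swap f p (l, y) r).
by apply: (@realizes_cons f p ps) rp => S'; apply: IH.
Qed.

Lemma joinP f a b ps ps' S : e (f a) (f b) ->
  join a b ps = Some ps' -> realizes f ps S -> realizes f ps' S.
Proof.
move=> eab; rewrite /join; case E: pick_end => [[x r]|] //.
case E': pick_end => [[y r']|] // [<-] rS.
have [q [R [cq rR pR]]] := pick_endP E rS.
have [q' [R' [cq' rR' pR']]] := pick_endP E' rR.
exists (rev q ++ q'), R'; split=> //.
  exact: chain_cat (chain_rev cq) cq' eab.
rewrite -catA; apply: perm_trans pR; apply: perm_cat pR'; exact/permEl/perm_rev.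
Qed.

Lemma seamP f a b ps ps' S : e (f a) (f b) ->
  seam a b ps = Some ps' -> realizes f ps S -> realizes f ps' S.
Proof.
move=> eab; rewrite /seam; case: pick_end => [c|].
  exact: joinP.
by case: pick_end => // -[<-].
Qed.

Lemma realizes_mem f p ps S : p \in ps ->
  realizes f ps S -> realizes f (p :: rem p ps) S.
Proof.
elim: ps S => // p' ps IH S; rewrite inE eq_sym /=.
case: eqP => [-> //|_] /= pin rS.
by apply: realizes_swap; apply: realizes_cons rS => S'; apply: IH.
Qed.

Lemma realizes_perm_eq f ps ps' S : perm_eq ps ps' ->
  realizes f ps S -> realizes f ps' S.
Proof.
elim: ps' ps S => [|p ps' IH] ps S pe; first by move/perm_nilP: pe => ->.
have pin : p \in ps by rewrite (perm_mem pe) mem_head.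
move/(realizes_mem pin); apply: realizes_cons => S'; apply: IH.
by rewrite -(perm_cons p) -(permPl (perm_to_rem pin)).
Qed.

Lemma normP f ps S : realizes f ps S -> realizes f (norm ps) S.
Proof.
move=> rS; apply: (@realizes_perm_eq f (map orient ps)).
  by rewrite perm_sym; apply/permEl/perm_sort.
elim: ps S rS => // p ps IH S rS.
have : realizes f (p :: map orient ps) S by apply: realizes_cons rS.
rewrite map_cons [orient p]/orient; case: ifP => // _; exact: realizes_flip.
Qed.

Lemma assignP f g (opt : nat -> seq nat) ps ps' S :
  (forall l l', l' \in opt l -> f l = g l') ->
  ps' \in assign opt ps -> realizes f ps S -> realizes g ps' S.
Proof.
move=> fg; elim: ps ps' S => [|p ps IH] ps' S /=; first by rewrite inE => /eqP->.
case/flatten_mapP=> a ain /flatten_mapP[b bin].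
case: eqP => // _ /mapP[q qin ->] [w [R [cq rR pR]]].
exists w, R; split=> //; first by rewrite /= -(fg _ _ ain) -(fg _ _ bin).
exact: IH rR.
Qed.

End Realization.

(** * Tiles *)

(* [Star] is the piece of a flower snark; [Delta] has its centre replaced by  *)
(* a triangle, [Bowtie] has its edge [0 - 3] replaced by two triangles with a *)
(* common vertex. Each makes the ring larger by 2 or 3 vertices.              *)
Inductive tile := Star | Delta | Bowtie.

Definition tile_size t := match t with Star => 4 | Delta => 6 | Bowtie => 7 end.

Definition tile_edges t := match t with
  | Star => [:: (0, 3); (1, 3); (2, 3)]
  | Delta => [:: (0, 3); (1, 4); (2, 5); (3, 4); (3, 5); (4, 5)]
  | Bowtie => [:: (0, 6); (0, 3); (3, 6); (3, 4); (3, 5); (4, 5); (1, 4); (2, 5)]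
  end.

Definition lport (t : tile) (s : nat) : nat := s.
(** Strand 0 enters a bowtie at vertex 0 and leaves it at vertex 6; all other strands touch a tile
    at a single vertex. *)
Definition rport (t : tile) (s : nat) : nat :=
  if t is Bowtie then (if s == 0 then 6 else s) else s.

(** Negation modulo 3. Having it at every seam makes all seams alike; around an odd ring the strands
    close up with one transposition, as in a flower snark. *)
Definition twist (s : nat) : nat := match s with 1 => 2 | 2 => 1 | _ => s end.

(* Labels: [s] and [3 + s] are the left and right ends of strand [s < 3] of a *)
(* run of tiles, 6 and 7 the ends of the path under construction, [8 + s] and *)
(* [11 + s] the two sides of a seam, and [20 + x] the vertex [x] of a tile.   *)
Definition lvertex x := 20 + x.

Definition port_labels t u v (l : nat) : seq nat :=
  let x := l - 20 in
  [seq s <- [:: 0; 1; 2] | lport t s == x] ++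
  [seq 3 + s | s <- [:: 0; 1; 2] & rport t s == x] ++
  (if u == Some x then [:: 6] else [::]) ++ (if v == Some x then [:: 7] else [::]).

(** Each edge of the tile is left out or used; [join] fails when a vertex would get degree 3 or a
    cycle would close. *)
Fixpoint grow (es : seq (nat * nat)) (ps : linkage) : seq linkage :=
  if es is (a, b) :: es' then
    grow es' ps ++
    (if join (lvertex a) (lvertex b) ps is Some ps' then grow es' ps' else [::])
  else [:: ps].

Definition has_label (l : nat) (ps : linkage) :=
  has (fun p => (p.1 == l) || (p.2 == l)) ps.

(** The ways to cover [cells], a whole tile or a tile without one vertex, where [u] and [v] are the
    ends of the path under construction lying in this tile, if any. *)
Definition moves t (cells : seq nat) (u v : option nat) : seq linkage :=
  let start := [seq (lvertex x, lvertex x) | x <- cells] in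
  [seq ps <- undup (map norm
     (flatten [seq assign (port_labels t u v) ps | ps <- grow (tile_edges t) start]))
  | ((u == None) || has_label 6 ps) && ((v == None) || has_label 7 ps)].

Definition right_mid l :=
  if l <= 2 then l else if l <= 5 then l + 5 else if l == 6 then 6 else 7.
Definition left_mid l :=
  if l <= 2 then l + 11 else if l <= 5 then l else if l == 6 then 6 else 7.

Definition no_mid (A : linkage) := all (fun p => (p.1 < 8) && (p.2 < 8)) A.

Definition comp (A B : linkage) : option linkage :=
  obind (fun C => if no_mid C then Some C else None)
    (obind (seam 10 (11 + twist 2)) (obind (seam 9 (11 + twist 1))
      (seam 8 (11 + twist 0) (relabel right_mid A ++ relabel left_mid B)))).

Definition close (A : linkage) : option linkage :=
  obind (seam 5 (twist 2)) (obind (seam 4 (twist 1)) (seam 3 (twist 0) A)).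

Definition closes A :=
  if close A is Some [:: (a, b)] then
    (a == 6) && (b == 7) || (a == 7) && (b == 6) else false.

Definition comps (As Bs : seq linkage) : seq linkage :=
  undup (flatten [seq pmap (fun B => omap norm (comp A B)) Bs | A <- As]).

Definition pass1 : seq linkage := moves Star (iota 0 4) None None.

(** Linkages of a run of [n] stars. By [pass1_moves] every tile offers those of a star, so they are
    valid for runs of arbitrary tiles. *)
Fixpoint pass (n : nat) : seq linkage :=
  if n is n'.+1 then (if n' is 0 then pass1 else comps (pass n') pass1)
  else [::].

Definition extend As n := if n is 0 then As else comps As (pass n).

(* [has], but stopping at the first success under call-by-value. *)
Fixpoint any (T : Type) (p : T -> bool) (s : seq T) :=
  if s is x :: s' then (if p x then true else any p s') else false.

Lemma anyE (T : Type) (p : T -> bool) s : any p s = has p s.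
Proof. by elim: s => //= x s ->; case: (p x). Qed.

Definition meets (As Bs : seq linkage) :=
  any (fun A => any (fun B => if comp A B is Some C then closes C else false) Bs) As.

Definition tile_adj t x y := ((x, y) \in tile_edges t) || ((y, x) \in tile_edges t).

Definition seam_adj t t' x y :=
  has (fun s => (x == rport t s) && (y == lport t' (twist s))) [:: 0; 1; 2].

Definition full t := iota 0 (tile_size t).

(* In the ring made of a tile [t], [n] tiles, a tile [t'] and [n'] tiles, any *)
(* vertices [x] of [t] and [y] of [t'] are joined by a path on all vertices,  *)
(* except one vertex of [t] if they are adjacent.                             *)
Definition span_check t n t' n' :=
  let Qs := [seq (y, extend (moves t' (full t') None (Some y)) n')
            | y <- full t'] in
  all (fun P => all (fun Q =>
    if (n == 0) && seam_adj t t' P.1 Q.1 || (n' == 0) && seam_adj t' t Q.1 P.1 then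
      any (fun m => if m == P.1 then false else
             meets (extend (moves t (rem m (full t)) (Some P.1) None) n)
                   Q.2)
          (full t)
    else meets P.2 Q.2) Qs)
  [seq (x, extend (moves t (full t) (Some x) None) n)
  | x <- full t].

(** Both ends lie in one tile. The rest of the ring has an even number of tiles, at least 6, and
    [pass 4] represents it. *)
Definition self_check t :=
  let Ps := pass 4 in
  let cells := full t in
  all (fun x => all (fun y =>
    if x == y then true else
    if tile_adj t x y then
      any (fun m => if (m == x) || (m == y) then false else
             meets (moves t (rem m cells) (Some x) (Some y)) Ps) cells
    else meets (moves t cells (Some x) (Some y)) Ps) cells) cells.

(** The pairs [(gap n, gap n')] for the runs between two tiles, where [n + n' = L - 2] is odd and at
    least 5; in [inner_gaps] both runs are nonempty. *)
Definition gaps := [:: (0, 3); (1, 4); (2, 3); (3, 0); (4, 1); (3, 2); (3, 4); (4, 3)].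
Definition inner_gaps := [:: (1, 4); (2, 3); (4, 1); (3, 2); (3, 4); (4, 3)].

(* Runs of 3 or more tiles may be replaced by runs of 3 or 4 tiles, according *)
(* to parity, by [pass_mono2].                                                *)
Definition gap n := if n <= 4 then n else if odd n then 3 else 4.

Lemma gapsP n n' : odd (n + n') -> 5 <= n + n' -> (gap n, gap n') \in gaps.
Proof.
rewrite /gap; case: (leqP n 4) (leqP n' 4) => [h|h] [h'|h'].
- by case: n h => [|[|[|[|[|]]]]] //; case: n' h' => [|[|[|[|[|]]]]].
- by case: n h => [|[|[|[|[|]]]]] //= _; case: ifP.
- by case: n' h' => [|[|[|[|[|]]]]] //= _; rewrite oddD; case: (odd n).
- by rewrite oddD; case: (odd n); case: (odd n').
Qed.

Lemma inner_gapsP n n' : 0 < n -> 0 < n' -> odd (n + n') -> 5 <= n + n' ->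
  (gap n, gap n') \in inner_gaps.
Proof.
rewrite /gap; case: (leqP n 4) (leqP n' 4) => [h|h] [h'|h'].
- by case: n h => [|[|[|[|[|]]]]] //; case: n' h' => [|[|[|[|[|]]]]].
- by case: n h => [|[|[|[|[|]]]]] //= _; case: ifP.
- by case: n' h' => [|[|[|[|[|]]]]] //= _; rewrite oddD; case: (odd n).
- by rewrite oddD; case: (odd n); case: (odd n').
Qed.

Lemma pass1_moves t : {subset pass1 <= moves t (full t) None None}.
Proof.
suff: all (mem (moves t (full t) None None)) pass1 by move/allP.
by case: t; vm_compute.
Qed.

(** Two more tiles lose no linkage of a run of 3 or 4, which by induction makes finitely many
    lengths represent all. *)
Lemma pass_mono2 n : n \in [:: 3; 4] -> {subset pass n <= pass n.+2}.
Proof.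
rewrite !inE => nn; suff: all (mem (pass n.+2)) (pass n) by move/allP.
by case/orP: nn => /eqP->; vm_compute.
Qed.

Section Strip.

Variables (T : eqType) (e : rel T).
Hypothesis sym_e : symmetric e.
Variables (ty : nat -> tile) (pos : nat -> nat -> T) (K : nat).
Variable cell : nat -> seq nat.
Hypothesis pos_tile : forall j x y, tile_adj (ty j) x y -> e (pos j x) (pos j y).
Hypothesis pos_seam : forall j s, s < 3 ->
  e (pos j (rport (ty j) s)) (pos j.+1 (lport (ty j.+1) (twist s))).
Hypothesis pos_close : pos K =1 pos 0.
Variables u v : T.

Definition run_ends i k l :=
  if l < 3 then pos i (lport (ty i) l)
  else if l < 6 then pos k (rport (ty k) (l - 3))
  else if l == 6 then u else v.

Definition cells i n := flatten [seq [seq pos j x | x <- cell j] | j <- iota i n].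

Definition run i n A := realizes e (run_ends i (i + n).-1) A (cells i n).

Lemma cellsD i n m : cells i (n + m) = cells i n ++ cells (i + n) m.
Proof. by rewrite /cells iotaD map_cat flatten_cat. Qed.

Lemma normr i n A : run i n A -> run i n (norm A).
Proof. exact: normP. Qed.

Lemma moves_run j ou ov A :
  (forall x, ou = Some x -> pos j x = u) -> (forall x, ov = Some x -> pos j x = v) ->
  A \in moves (ty j) (cell j) ou ov -> run j 1 A.
Proof.
move=> hu hv; rewrite mem_filter => /andP[_].
rewrite mem_undup => /mapP[B + ->] => /flatten_mapP[ps psin Bin]; apply: normr.
pose f l := pos j (l - 20).
have : realizes e f ps (cells j 1).
  rewrite /cells /= cats0.
  move: psin; set es := tile_edges _ => psin.
  have sub : {subset es <= tile_edges (ty j)} by [].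
  have : realizes e f [seq (lvertex x, lvertex x) | x <- cell j]
                  [seq pos j x | x <- cell j].
    elim: (cell j) => //= x s IH; exists [:: pos j x], [seq pos j y | y <- s].
    by split=> //=; rewrite /f /lvertex addKn eqxx.
  elim: es sub [seq _ | _ <- _] psin => [|[a b] es IH] sub qs /=.
    by rewrite inE => /eqP ->.
  rewrite mem_cat => /orP[|].
    by apply: IH => p pin; apply: sub; rewrite inE pin orbT.
  case E: join => [qs'|] // h r; apply: (IH _ _ h) => [p pin|].
    by apply: sub; rewrite inE pin orbT.
  apply: (joinP sym_e _ E r); rewrite /f /lvertex !addKn; apply: pos_tile.
  by rewrite /tile_adj sub // mem_head.
rewrite /run addn1 /=; apply: assignP Bin => l l'.
rewrite /port_labels !mem_cat /f => /or4P[].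
- rewrite mem_filter => /andP[/eqP <-]; rewrite !inE.
  by case/or3P=> /eqP->.
- case/mapP=> s; rewrite mem_filter => /andP[/eqP <-]; rewrite !inE.
  by case/or3P=> /eqP-> ->.
- by case: eqP => // /hu ->; rewrite inE => /eqP->.
- by case: eqP => // /hv ->; rewrite inE => /eqP->.
Qed.

Lemma comp_run i n m A B C : 0 < n -> 0 < m ->
  run i n A -> run (i + n) m B -> comp A B = Some C -> run i (n + m) C.
Proof.
move=> n0 m0 rA rB; rewrite /comp.
pose k := (i + n).-1; pose k' := (i + (n + m)).-1.
pose g l := if l < 3 then pos i (lport (ty i) l)
  else if l < 6 then pos k' (rport (ty k') (l - 3))
  else if l == 6 then u
  else if 8 <= l < 11 then pos k (rport (ty k) (l - 8))
  else if 11 <= l < 14 then pos k.+1 (lport (ty k.+1) (l - 11)) else v.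
have ek : k.+1 = i + n by rewrite prednK // addn_gt0 n0 orbT.
have rAB : realizes e g (relabel right_mid A ++ relabel left_mid B) (cells i (n + m)).
  rewrite cellsD; apply: realizes_cat.
    apply: realizes_relabel rA => p _; rewrite /run_ends -/k.
    suff h l : (if l < 3 then pos i (lport (ty i) l)
       else if l < 6 then pos k (rport (ty k) (l - 3)) else if l == 6 then u else v)
       = g (right_mid l) by split; apply: h.
    by rewrite /right_mid; case: l => [|[|[|[|[|[|[|l]]]]]]].
  apply: realizes_relabel rB => p _; rewrite /run_ends -addnA -/k' -ek.
  suff h l : (if l < 3 then pos k.+1 (lport (ty k.+1) l)
     else if l < 6 then pos k' (rport (ty k') (l - 3)) else if l == 6 then u else v)
     = g (left_mid l) by split; apply: h.
  by rewrite /left_mid; case: l => [|[|[|[|[|[|[|l]]]]]]].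
case E0: seam => [C0|] //=; have r0 := seamP sym_e (pos_seam k (isT : 0 < 3)) E0 rAB.
case E1: seam => [C1|] //=; have r1 := seamP sym_e (pos_seam k (isT : 1 < 3)) E1 r0.
case E2: seam => [C2|] //=; have r2 := seamP sym_e (pos_seam k (isT : 2 < 3)) E2 r1.
case: ifP => // /allP small [<-].
apply: realizes_eq r2 => p /small /andP[l1 l2].
have h l : l < 8 -> g l = run_ends i k' l.
  by case: l => [|[|[|[|[|[|[|[|l]]]]]]]].
by split; apply: h.
Qed.

Lemma closes_run A : 0 < K -> run 0 K A -> closes A ->
  exists2 q, chain e u v q & perm_eq q (cells 0 K).
Proof.
move=> K0 rA; rewrite /closes /close.
have ps s : s < 3 -> e (pos K.-1 (rport (ty K.-1) s)) (pos 0 (lport (ty 0) (twist s))).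
  by move=> s3; have := pos_seam K.-1 s3; rewrite (prednK K0) pos_close.
case E0: seam => [C0|] //=; have r0 := seamP sym_e (ps 0 isT) E0 rA.
case E1: seam => [C1|] //=; have r1 := seamP sym_e (ps 1 isT) E1 r0.
case E2: seam => [[|[a b] [|]]|] //; have := seamP sym_e (ps 2 isT) E2 r1.
case=> q [R [cq -> pR]]; rewrite cats0 in pR.
case/orP=> /andP[/eqP ea /eqP eb]; subst a b; first by exists q.
exists (rev q); first exact: chain_rev.
by apply: perm_trans pR; apply/permEl/perm_rev.
Qed.

Lemma comps_run i n m As Bs : 0 < n -> 0 < m ->
  (forall A, A \in As -> run i n A) -> (forall B, B \in Bs -> run (i + n) m B) ->
  forall C, C \in comps As Bs -> run i (n + m) C.
Proof.
move=> n0 m0 rA rB C; rewrite mem_undup => /flatten_mapP[A Ain].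
rewrite mem_pmap => /mapP[B Bin]; case E: comp => [D|] //= [->].
by apply: normr; apply: comp_run E => //; [apply: rA | apply: rB].
Qed.

Lemma pass1_run j A : cell j = full (ty j) -> A \in pass1 -> run j 1 A.
Proof.
by move=> cj /(@pass1_moves (ty j)); rewrite -cj; apply: moves_run.
Qed.

Lemma passS_run i n As : 0 < n -> cell (i + n) = full (ty (i + n)) ->
  (forall A, A \in As -> run i n A) ->
  forall C, C \in comps As pass1 -> run i n.+1 C.
Proof.
move=> n0 cn rA C; rewrite -addn1; apply: comps_run => // B.
exact: pass1_run.
Qed.

Lemma pass_run i n A : 0 < n ->
  (forall j, i <= j < i + n -> cell j = full (ty j)) ->
  A \in pass (gap n) -> run i n A.
Proof.
move=> n0 cj; have [m mn] := ubnP n; elim: m n mn A n0 cj => // m IH n mn A n0 cj.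
have [n4|n4] := leqP n 4.
  have -> : gap n = n by rewrite /gap n4.
  case: n n0 n4 mn cj => [|[|n]] // _ n4 mn cj.
    by apply: pass1_run; apply: cj; lia.
  apply: passS_run => //; first by apply: cj; lia.
  move=> B Bin; apply: IH => // [j jn|]; first by apply: cj; lia.
  by rewrite /gap ltnW.
case: n n0 n4 mn cj => [|[|n]] // _ n4 mn cj.
(* Dropping the last two tiles preserves [gap]; [pass_mono2] rebuilds the linkage from the shorter
   run through these tiles. *)
have gn : gap n.+2 = gap n.
  rewrite /gap leqNgt n4 /= negbK.
  by case: n n4 {mn cj} => [|[|[|[|[|n]]]]] //= _.
rewrite gn => Ain.
have g34 : gap n \in [:: 3; 4].
  rewrite /gap; case: (n) n4 => [|[|[|[|[|n']]]]] // _.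
  by rewrite /=; case: ifP.
have := pass_mono2 g34 Ain.
have -> : pass (gap n).+2 = comps (comps (pass (gap n)) pass1) pass1.
  by move: g34; rewrite !inE => /orP[] /eqP->.
apply: passS_run => //; first by apply: cj; lia.
apply: passS_run; [lia | by apply: cj; lia |].
by move=> B; apply: IH => //; [lia | lia | move=> j jn; apply: cj; lia].
Qed.

Lemma extend_run i n m As : 0 < n ->
  (forall j, i + n <= j < i + n + m -> cell j = full (ty j)) ->
  (forall A, A \in As -> run i n A) ->
  forall C, C \in extend As (gap m) -> run i (n + m) C.
Proof.
move=> n0 cj rA C; case: m cj => [|m] cj; first by rewrite addn0; apply: rA.
have -> : extend As (gap m.+1) = comps As (pass (gap m.+1)).
  by rewrite /gap; case: ifP => // _; case: ifP.
by apply: comps_run => // B; apply: pass_run.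
Qed.

Lemma meets_run n As Bs : 0 < n < K ->
  (forall A, A \in As -> run 0 n A) -> (forall B, B \in Bs -> run n (K - n) B) ->
  meets As Bs -> exists2 q, chain e u v q & perm_eq q (cells 0 K).
Proof.
case/andP=> n0 nK rA rB; rewrite /meets anyE => /hasP[A /rA {}rA].
rewrite anyE => /hasP[B /rB {}rB].
case E: comp => [C|] //; apply: closes_run; first lia.
have -> : K = n + (K - n) by lia.
by apply: comp_run E => //; lia.
Qed.

End Strip.

Lemma self_checks t : self_check t.
Proof. by case: t; vm_compute. Qed.

Lemma span_star t c : c \in gaps -> span_check t c.1 Star c.2.
Proof.
move: c; apply/allP; case: t.
- by vm_compute.
- by vm_compute.
- by vm_compute.
Qed.

Lemma span_delta t c : c \in (if t is Bowtie then inner_gaps else gaps) ->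
  span_check t c.1 Delta c.2.
Proof.
move: c; apply/allP; case: t.
- by vm_compute.
- by vm_compute.
- by vm_compute.
Qed.

(** * Rings of tiles *)

Section Ring.

Variables (L : nat) (tt : nat -> tile).

Definition ring_adj (p q : nat * nat) :=
  [|| (p.1 == q.1) && tile_adj (tt p.1) p.2 q.2,
      (q.1 == p.1.+1 %% L) && seam_adj (tt p.1) (tt q.1) p.2 q.2
    | (p.1 == q.1.+1 %% L) && seam_adj (tt q.1) (tt p.1) q.2 p.2].

Definition ring_vertices := flatten [seq [seq (i, x) | x <- full (tt i)] | i <- iota 0 L].

Lemma tile_adjC t x y : tile_adj t x y = tile_adj t y x.
Proof. by rewrite /tile_adj orbC. Qed.

Lemma ring_adjC : symmetric ring_adj.
Proof.
move=> p q; rewrite /ring_adj orbCA orbC -orbA; congr (_ || _).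
by rewrite eq_sym; case: eqP => //= ->; rewrite tile_adjC.
Qed.

Lemma mem_ring i x : ((i, x) \in ring_vertices) = (i < L) && (x < tile_size (tt i)).
Proof.
apply/flatten_mapP/andP => [[j]|[iL xi]].
  rewrite mem_iota => /andP[_ jL] /mapP[y]; rewrite mem_iota => /andP[_ yj] [-> ->].
  by split.
by exists i; rewrite ?mem_iota //; apply: map_f; rewrite mem_iota.
Qed.

Lemma ring_uniq : uniq ring_vertices.
Proof.
rewrite /ring_vertices -/(allpairs_dep _ _ _).
apply: allpairs_uniq_dep; rewrite ?iota_uniq //; first by move=> *; apply: iota_uniq.
by move=> [i x] [j y] _ _ /= [-> ->].
Qed.

Lemma perm_rotation k : k < L ->
  perm_eq [seq (k + j) %% L | j <- iota 0 L] (iota 0 L).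
Proof.
move=> kL; have -> : [seq (k + j) %% L | j <- iota 0 L] = rot k (iota 0 L).
  rewrite -{1 2}(subnKC (ltnW kL)) addnC iotaD map_cat /rot add0n addnC.
  rewrite drop_iota take_iota add0n.
  congr (_ ++ _); last (have -> : minn k L = k by lia).
    rewrite -[X in _ = iota X _](addn0 k) iotaDl; apply/eq_in_map => j.
    by rewrite mem_iota => jL; rewrite modn_small //; lia.
  rewrite -[X in iota X k](addn0 (L - k)) iotaDl -map_comp -[RHS]map_id.
  apply/eq_in_map => j; rewrite mem_iota => jk /=.
  have -> : k + (L - k + j) = k + (L - k) + j by lia.
  by rewrite modnDl modn_small //; lia.
exact/permEl/perm_rot.
Qed.

Section View.

Variable k : nat.
Hypothesis kL : k < L.

(** The ring read from tile [k] on, which gets position 0; [vcell] omits a vertex of that tile if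
    one is to be missed. *)
Definition vpos j (x : nat) := ((k + j) %% L, x).
Definition vty j := tt ((k + j) %% L).
Definition vcell (om : option nat) j :=
  if om is Some m then (if j == 0 then rem m (full (vty j)) else full (vty j))
  else full (vty j).

Lemma vpos_tile j x y : tile_adj (vty j) x y -> ring_adj (vpos j x) (vpos j y).
Proof. by rewrite /ring_adj /= eqxx => ->. Qed.

Lemma vpos_seam j s : s < 3 ->
  ring_adj (vpos j (rport (vty j) s)) (vpos j.+1 (lport (vty j.+1) (twist s))).
Proof.
move=> s3; rewrite /ring_adj /=.
have -> : (k + j.+1) %% L = ((k + j) %% L).+1 %% L.
  by rewrite addnS -addn1 -[in RHS]addn1 modnDml.
rewrite eqxx /=; apply/orP; right; apply/orP; left.
apply/hasP; exists s; last by rewrite /= /vty !eqxx.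
by case: s s3 => [|[|[|]]].
Qed.

Lemma vpos_close : vpos L =1 vpos 0.
Proof. by move=> x; rewrite /vpos modnDr addn0. Qed.

Lemma vcells om : (forall m, om = Some m -> m < tile_size (vty 0)) ->
  perm_eq ((if om is Some m then [:: vpos 0 m] else [::]) ++
           cells vpos (vcell om) 0 L) ring_vertices.
Proof.
move=> hm; apply: (@perm_trans _ (cells vpos (vcell None) 0 L)); last first.
  rewrite /cells /=.
  have -> : [seq [seq vpos j x | x <- full (vty j)] | j <- iota 0 L] =
     [seq [seq (i, x) | x <- full (tt i)] | i <- [seq (k + j) %% L | j <- iota 0 L]].
    by rewrite -map_comp.
  by apply: perm_flatten; apply: perm_map; apply: perm_rotation.
case: om hm => [m|] // hm; rewrite /cells.
case: (L) kL => // L' _; rewrite /= -cat_cons; apply: perm_cat.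
  rewrite -map_cons; apply: perm_map; rewrite perm_sym; apply: perm_to_rem.
  by rewrite mem_iota; apply: hm.
suff -> : [seq [seq vpos j x | x <- if j == 0 then rem m (full (vty j)) else full (vty j)]
             | j <- iota 1 L'] =
   [seq [seq vpos j x | x <- full (vty j)] | j <- iota 1 L'] by [].
by apply/eq_in_map => j; rewrite mem_iota; case: j.
Qed.

End View.

Hypotheses (L7 : 7 <= L) (oddL : odd L).

Lemma self_path k x y : k < L -> x < tile_size (tt k) -> y < tile_size (tt k) ->
  x != y ->
  exists om q, [/\ chain ring_adj (k, x) (k, y) q,
    perm_eq ((if om is Some m then [:: (k, m)] else [::]) ++ q) ring_vertices
    & om = None \/ ring_adj (k, x) (k, y)].
Proof.
move=> kL xk yk xy.
have k0 : (k + 0) %% L = k by rewrite addn0 modn_small.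
have t0 : vty k 0 = tt k by rewrite /vty k0.
have g4 : gap L.-1 = 4.
  move: oddL L7; rewrite /gap; case: (L) => // L' /= /negbTE -> L6.
  by rewrite leqNgt (_ : 4 < L') //; apply: ltnW.
have key om : (forall m, om = Some m -> m < tile_size (tt k)) ->
    meets (moves (tt k) (vcell k om 0) (Some x) (Some y)) (pass 4) ->
    exists2 q, chain ring_adj (k, x) (k, y) q &
      perm_eq ((if om is Some m then [:: (k, m)] else [::]) ++ q) ring_vertices.
  move=> hm hmeet.
  have [|||q cq pq] := @meets_run _ _ ring_adjC (vty k) (vpos k) L (vcell k om)
    (@vpos_seam k) (vpos_close k) (k, x) (k, y) 1 _ (pass 4) _ _ _ hmeet.
  - lia.
  - move=> A; rewrite -t0.
    by apply: (moves_run ring_adjC (@vpos_tile k)) => z [<-]; rewrite /vpos k0.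
  - move=> B; rewrite subn1 -g4.
    apply: (pass_run ring_adjC (@vpos_tile k) (@vpos_seam k)); first lia.
    by move=> j jL; rewrite /vcell; case: (om) => [m|] //; case: j jL.
  exists q => //; have := vcells kL (om := om); rewrite t0 => /(_ hm).
  rewrite /vpos k0; apply: perm_trans.
  by rewrite perm_cat2l; exact: pq.
have /allP/(_ x) := self_checks (tt k); rewrite mem_iota => /(_ xk)/allP/(_ y).
rewrite mem_iota => /(_ yk); rewrite (negbTE xy) /=; case: ifP => [a|_].
  rewrite anyE => /hasP[m]; rewrite mem_iota => mk; case: ifP => // _ h.
  have [m' [<-] //||q cq pq] := key (Some m).
    by rewrite /vcell /= t0.
  by exists (Some m), q; split=> //; right; rewrite /ring_adj /= eqxx a.
move=> h; have [||q cq pq] := key None => //; first by rewrite /vcell t0.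
by exists None, q; split=> //; left.
Qed.

Lemma span_path k k' x y : k < k' < L -> x < tile_size (tt k) -> y < tile_size (tt k') ->
  span_check (tt k) (gap (k' - k).-1) (tt k') (gap (L - 2 - (k' - k).-1)) ->
  exists om q, [/\ chain ring_adj (k, x) (k', y) q,
    perm_eq ((if om is Some m then [:: (k, m)] else [::]) ++ q) ring_vertices
    & om = None \/ ring_adj (k, x) (k', y)].
Proof.
case/andP=> kk' k'L xk yk.
set n := (k' - k).-1; set n' := L - 2 - n => hs.
have kL : k < L by lia.
have k0 : (k + 0) %% L = k by rewrite addn0 modn_small.
have kn : (k + (1 + n)) %% L = k' by rewrite modn_small; lia.
have t0 : vty k 0 = tt k by rewrite /vty k0.
have tn : vty k (1 + n) = tt k' by rewrite /vty kn.
have key om : (forall m, om = Some m -> m < tile_size (tt k)) ->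
    meets (extend (moves (tt k) (vcell k om 0) (Some x) None) (gap n))
          (extend (moves (tt k') (full (tt k')) None (Some y)) (gap n')) ->
    exists2 q, chain ring_adj (k, x) (k', y) q &
      perm_eq ((if om is Some m then [:: (k, m)] else [::]) ++ q) ring_vertices.
  move=> hm hmeet.
  have cj j : 0 < j -> vcell k om j = full (vty k j).
    by rewrite /vcell; case: (om) => [m|] //; case: j.
  have [|||q cq pq] := @meets_run _ _ ring_adjC (vty k) (vpos k) L (vcell k om)
    (@vpos_seam k) (vpos_close k) (k, x) (k', y) (1 + n) _ _ _ _ _ hmeet.
  - lia.
  - move=> A; apply: (extend_run ring_adjC (@vpos_tile k) (@vpos_seam k)) => //.
      by move=> j jn; apply: cj; lia.
    move=> {}A; rewrite -t0.
    by apply: (moves_run ring_adjC (@vpos_tile k)) => // z [<-]; rewrite /vpos k0.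
  - have -> : L - (1 + n) = 1 + n' by lia.
    move=> B; apply: (extend_run ring_adjC (@vpos_tile k) (@vpos_seam k)) => //.
      by move=> j jn; apply: cj; lia.
    move=> {}B; rewrite -tn -(cj (1 + n)) //.
    by apply: (moves_run ring_adjC (@vpos_tile k)) => // z [<-]; rewrite /vpos kn.
  exists q => //; have := vcells kL (om := om); rewrite t0 => /(_ hm).
  rewrite /vpos k0; apply: perm_trans.
  by rewrite perm_cat2l; exact: pq.
have xin : x \in full (tt k) by rewrite mem_iota.
have yin : y \in full (tt k') by rewrite mem_iota.
have := allP (allP hs _ (map_f _ xin)) _ (map_f _ yin); rewrite /=.
case: ifP => [a|_].
  rewrite anyE => /hasP[m]; rewrite mem_iota => mk; case: ifP => // _ h.
  have [m' [<-] //||q cq pq] := key (Some m).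
    by rewrite /vcell /= t0.
  exists (Some m), q; split=> //; right; rewrite /ring_adj /=.
  have g0 p : (gap p == 0) = (p == 0).
    by rewrite /gap; case: (p) => [|[|[|[|[|p']]]]] //=; case: ifP.
  move: a; rewrite !g0 => /orP[] /andP[/eqP nz ->]; rewrite !andbT.
    by rewrite (_ : k' == _) ?orbT // modn_small; lia.
  have -> : k'.+1 = L by lia.
  by rewrite modnn (_ : k == 0) ?orbT //; lia.
move=> h; have [||q cq pq] := key None => //; first by rewrite /vcell t0.
by exists None, q; split=> //; left.
Qed.

End Ring.

(** * Rings are not Hamiltonian *)

Fixpoint sublists (T : Type) (s : seq T) : seq (seq T) :=
  if s is x :: s' then sublists s' ++ [seq x :: r | r <- sublists s'] else [:: [::]].

Lemma filter_sublists (T : eqType) (p : pred T) s : filter p s \in sublists s.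
Proof.
elim: s => [|x s IH] //=; rewrite mem_cat; case: ifP => _.
  by rewrite map_f ?orbT.
by rewrite IH.
Qed.

Definition pairs_of (s : seq nat) := [seq r <- sublists s | size r == 2].

Section CheckAll.

Variables (opts : nat -> seq (seq nat)) (leaf : seq (nat * seq nat) -> bool).

(* Enumerates the possible choices of the two neighbours of each vertex in a  *)
(* spanning subgraph of degree 2.                                             *)
Fixpoint check_all vs asg :=
  if vs is x :: vs' then
    all (fun o => if all (fun c => (c.1 \in o) == (x \in c.2)) asg
                  then check_all vs' ((x, o) :: asg) else true) (opts x)
  else leaf asg.

Lemma check_allP (U : nat -> seq nat) vs done :
  (forall x, x \in vs -> U x \in opts x) ->
  (forall x y, x \in vs ++ done -> y \in vs ++ done -> (x \in U y) = (y \in U x)) ->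
  check_all vs [seq (x, U x) | x <- done] ->
  leaf [seq (x, U x) | x <- catrev vs done].
Proof.
elim: vs done => [|x vs IH] //= done hU sU /allP/(_ (U x) (hU x (mem_head _ _))).
case: ifP => [_ h|/negP no _]; last first.
  case: no; apply/allP => c /mapP[y yd ->] /=; apply/eqP; apply: sU.
    by rewrite inE mem_cat yd !orbT.
  by rewrite inE eqxx.
apply: IH => //.
- by move=> y yv; apply: hU; rewrite inE yv orbT.
- by move=> y z; rewrite !mem_cat !inE => hy hz; apply: sU;
    rewrite !inE !mem_cat; [move: hy|move: hz]; case: (_ == x); rewrite ?orbT ?orbF //= => ->.
Qed.

Lemma check_all_rev (U : nat -> seq nat) vs :
  (forall x, x \in vs -> U x \in opts x) ->
  (forall x y, x \in vs -> y \in vs -> (x \in U y) = (y \in U x)) ->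
  check_all vs [::] -> leaf [seq (x, U x) | x <- rev vs].
Proof.
move=> hU sU h; have := @check_allP U vs [::] hU; rewrite catrevE !cats0.
by apply; rewrite ?cats0.
Qed.

End CheckAll.

Definition lookup (asg : seq (nat * seq nat)) x : seq nat :=
  if [seq c.2 | c <- asg & c.1 == x] is o :: _ then o else [::].

Lemma lookupP U vs x : x \in vs -> lookup [seq (y, U y) | y <- vs] x = U x.
Proof.
rewrite /lookup; elim: vs => //= y vs IH; rewrite inE eq_sym.
by case: eqP => [->|_] //= /IH.
Qed.

(* Neighbours of a vertex of a tile: the vertices of the tile keep their      *)
(* numbers, [10 + s] and [20 + s] stand for the neighbours along strand [s].  *)
Definition codes t x : seq nat :=
  [seq y <- full t | tile_adj t x y] ++
  [seq 10 + s | s <- [:: 0; 1; 2] & lport t s == x] ++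
  [seq 20 + s | s <- [:: 0; 1; 2] & rport t s == x].

(* With [h] the unused strand of a cut, the two other strands are told apart  *)
(* by the residue of [s - h] modulo 3.                                        *)
Definition shade s h := (s + 3 - h) %% 3 == 1.

Section Leaf.

Variables (t : tile) (U : nat -> seq nat).

Definition usedl s := 10 + s \in U (lport t s).
Definition usedr s := 20 + s \in U (rport t s).
Definition holel := find (fun s => ~~ usedl s) [:: 0; 1; 2].
Definition holer := find (fun s => ~~ usedr s) [:: 0; 1; 2].
Definition countl := count usedl [:: 0; 1; 2].
Definition countr := count usedr [:: 0; 1; 2].

Definition closed_part (S : seq nat) :=
  (S != [::]) && all (fun x => all (fun c => c \in S) (U x)) S.

(** [S] is a colour class: the colour is constant along used edges inside the tile and prescribed by
    [shade] at used strands. Since [twist] negates modulo 3, [shade] takes its arguments in opposite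
    order on the two sides, which makes colours agree across a seam. *)
Definition coloring (S : seq nat) :=
  [&& all (fun x => all (fun c => (c < 10) ==> ((c \in S) == (x \in S))) (U x)) (full t),
      all (fun s => usedl s ==> ((lport t s \in S) == shade s holel)) [:: 0; 1; 2] &
      all (fun s => usedr s ==> ((rport t s \in S) == shade holer s)) [:: 0; 1; 2]].

(** A choice of two neighbours for each vertex either closes up inside the tile or uses four strand
    ends in all. If two of these are on each side, the prescribed colours extend to the tile and
    both occur. *)
Definition leaf_check :=
  if any closed_part (sublists (full t)) then true else
  (countl + countr == 4) &&
  if countl == 2 then
    [&& any coloring (sublists (full t)),
       has (fun s => usedl s && shade s holel) [:: 0; 1; 2]
     & has (fun s => usedl s && ~~ shade s holel) [:: 0; 1; 2]]
  else true.

End Leaf.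

Definition tile_check t :=
  check_all (fun x => pairs_of (codes t x)) (fun asg => leaf_check t (lookup asg))
            (full t) [::].

Lemma tile_checks t : tile_check t.
Proof. by case: t; vm_compute. Qed.

Section CycleNext.

Variables (T : eqType) (s : seq T).
Hypothesis us : uniq s.

(** The successor map reaches every vertex of the cycle, so whatever it propagates holds
    throughout. *)
Lemma next_invariant (R : rel T) : transitive R ->
  (forall x, x \in s -> R x (next s x)) -> forall x y, x \in s -> y \in s -> R x y.
Proof.
move=> tR hR x y xs ys; have : cycle R s.
  apply: (@sub_in_cycle _ (mem s) (fun x y => next s x == y)) (cycle_next us).
    by move=> a b ain _ /eqP <-; apply: hR.
  exact/allP.
by rewrite cycle_all2rel // => /allrelP; apply.
Qed.

Definition used x y := (next s x == y) || (next s y == x).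

Lemma usedC x y : used x y = used y x.
Proof. by rewrite /used orbC. Qed.

Lemma usedE x y : x \in s -> y \in s -> used x y = (y == next s x) || (y == prev s x).
Proof.
move=> xs ys; rewrite /used eq_sym; congr (_ || _).
by apply/eqP/eqP => [<-|->]; rewrite ?prev_next // next_prev.
Qed.

Lemma next_neq_prev x : x \in s -> 2 < size s -> next s x != prev s x.
Proof.
move=> xs s3; apply/eqP => e; have := next_prev us x; rewrite -e => e2.
have [i s' es] := rot_to xs.
have us' : uniq (x :: s') by rewrite -es rot_uniq.
have := size_rot i s; rewrite es => sz.
have e2' : next (x :: s') (next (x :: s') x) = x by rewrite -es !next_rot.
case: s' us' sz e2' {es} => [|a [|b l]] /=; try lia.
rewrite !inE !negb_or => /andP[/and3P[xa xb _] _] _.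
by rewrite eqxx /= eq_sym (negbTE xa) eqxx => e'; rewrite e' eqxx in xb.
Qed.

(** The list [l] encodes, through [f], candidates including all neighbours of [x]; the used ones are
    the predecessor and the successor, which differ on a cycle longer than 2. *)
Lemma used_size (C : eqType) (e : rel T) (f : C -> T) (l : seq C) x :
  symmetric e -> cycle e s -> 2 < size s -> x \in s -> uniq l ->
  {in l &, injective f} -> (forall c, c \in l -> f c \in s) ->
  (forall y, y \in s -> e x y -> exists2 c, c \in l & y = f c) ->
  size [seq c <- l | used x (f c)] = 2.
Proof.
move=> sym cs s3 xs ul inj fs complete.
have ns : next s x \in s by rewrite mem_next.
have prs : prev s x \in s by rewrite mem_prev.
have [c cl ec] := complete _ ns (next_cycle cs xs).
have [d dl ed] : exists2 d, d \in l & prev s x = f d.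
  by apply: complete => //; rewrite sym; apply: prev_cycle.
have cd : c != d.
  by apply: contraNneq (next_neq_prev xs s3) => e'; rewrite ec ed e'.
have eqf : [seq c <- l | used x (f c)] =i [:: c; d].
  move=> z; rewrite mem_filter !inE.
  have [zl|zl] := boolP (z \in l); last first.
    by rewrite andbF; apply/esym/negbTE; apply: contra zl => /orP[] /eqP->.
  rewrite andbT usedE ?fs // ec ed.
  by congr (_ || _); apply/eqP/eqP => [|->//]; apply: inj.
by rewrite (perm_size (uniq_perm (filter_uniq _ ul) _ eqf)) //= inE cd.
Qed.

End CycleNext.

Section CyclicSuccessor.

Variable L : nat.
Hypothesis L3 : 2 < L.

Lemma predL i : i < L -> ((i + L.-1) %% L).+1 %% L = i.
Proof.
move=> iL; rewrite -addn1 modnDml addn1 -addnS prednK ?modnDr ?modn_small //; lia.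
Qed.

Lemma succL i : i < L -> (i.+1 %% L + L.-1) %% L = i.
Proof. move=> iL; rewrite modnDml addSnnS prednK ?modnDr ?modn_small //; lia. Qed.

Lemma succ_neq i : i < L -> i.+1 %% L != i.
Proof.
move=> iL; have [h|h] := ltnP i.+1 L; first by rewrite modn_small //; lia.
have -> : i.+1 = L by lia.
by rewrite modnn; lia.
Qed.

Lemma pred_neq i : i < L -> (i + L.-1) %% L != i.
Proof.
move=> iL; apply/eqP => e; have := predL iL; rewrite e => /eqP.
by rewrite (negbTE (succ_neq iL)).
Qed.

Lemma pred_succ_neq i : i < L -> (i + L.-1) %% L != i.+1 %% L.
Proof.
move=> iL; apply/eqP => e; have := predL iL; rewrite e => /eqP.
have [h|h] := ltnP i.+2 L; first by rewrite (modn_small (ltnW h)) modn_small //; lia.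
have [e1|e1] := eqVneq i.+1 L; first by rewrite e1 modnn modn_small; lia.
have e2 : i.+2 = L by lia.
by rewrite (@modn_small i.+1) ?e2 ?modnn; lia.
Qed.

End CyclicSuccessor.

Section RingNotHamiltonian.

Variables (L : nat) (tt : nat -> tile).
Hypotheses (L3 : 2 < L) (oddL : odd L).

Variable s : seq (nat * nat).
Hypothesis ps : perm_eq s (ring_vertices L tt).
Hypothesis cs : cycle (ring_adj L tt) s.

Let us : uniq s. Proof. by rewrite (perm_uniq ps) ring_uniq. Qed.

Let mems i x : ((i, x) \in s) = (i < L) && (x < tile_size (tt i)).
Proof. by rewrite (perm_mem ps) mem_ring. Qed.

(** Decodes [codes]: the vertex of the ring that the code [c] means when seen from tile [i]. *)
Definition nb i c : nat * nat :=
  if c < 10 then (i, c)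
  else if c < 20 then
    let j := (i + L.-1) %% L in (j, rport (tt j) (twist (c - 10)))
  else let j := i.+1 %% L in (j, lport (tt j) (twist (c - 20))).

Definition used_codes i x := [seq c <- codes (tt i) x | used s (i, x) (nb i c)].

Let predL i := @predL L L3 i.
Let succL i := @succL L L3 i.
Let succ_neq i := @succ_neq L L3 i.
Let pred_neq i := @pred_neq L L3 i.
Let pred_succ_neq i := @pred_succ_neq L L3 i.

Lemma twistK a : a < 3 -> twist (twist a) = a.
Proof. by case: a => [|[|[|]]]. Qed.

Lemma twist3 a : a < 3 -> twist a < 3.
Proof. by case: a => [|[|[|]]]. Qed.

Lemma codesP t x c : c \in codes t x ->
  [\/ c < tile_size t /\ tile_adj t x c,
      exists2 a, a < 3 & c = 10 + a /\ x = lport t a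
    | exists2 a, a < 3 & c = 20 + a /\ x = rport t a].
Proof.
rewrite !mem_cat => /or3P[].
- by rewrite mem_filter mem_iota => /andP[h ct]; constructor 1.
- case/mapP=> a; rewrite mem_filter => /andP[/eqP<- a3] ->; constructor 2.
  by exists a => //; move: a3; rewrite !inE => /or3P[] /eqP->.
- case/mapP=> a; rewrite mem_filter => /andP[/eqP<- a3] ->; constructor 3.
  by exists a => //; move: a3; rewrite !inE => /or3P[] /eqP->.
Qed.

Lemma codes_l t a : a < 3 -> 10 + a \in codes t (lport t a).
Proof.
move=> a3; rewrite !mem_cat; apply/orP; right; apply/orP; left; apply: map_f.
by rewrite mem_filter eqxx; case: a a3 => [|[|[|]]].
Qed.

Lemma codes_r t a : a < 3 -> 20 + a \in codes t (rport t a).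
Proof.
move=> a3; rewrite !mem_cat; apply/orP; right; apply/orP; right; apply: map_f.
by rewrite mem_filter eqxx; case: a a3 => [|[|[|]]].
Qed.

Lemma tile_size_lt t : tile_size t < 10. Proof. by case: t. Qed.

Lemma lport_lt t a : a < 3 -> lport t a < tile_size t.
Proof. by case: t; case: a => [|[|[|]]]. Qed.

Lemma rport_lt t a : a < 3 -> rport t a < tile_size t.
Proof. by case: t; case: a => [|[|[|]]]. Qed.

Lemma rport_inj t a b : a < 3 -> b < 3 -> rport t a = rport t b -> a = b.
Proof. by case: t; case: a => [|[|[|]]] //; case: b => [|[|[|]]]. Qed.

Lemma nb_l i a : a < 3 -> nb i (10 + a) =
  ((i + L.-1) %% L, rport (tt ((i + L.-1) %% L)) (twist a)).
Proof. by case: a => [|[|[|]]]. Qed.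

Lemma nb_r i a : a < 3 -> nb i (20 + a) =
  (i.+1 %% L, lport (tt (i.+1 %% L)) (twist a)).
Proof. by case: a => [|[|[|]]]. Qed.

Lemma nb_local i c : c < 10 -> nb i c = (i, c).
Proof. by rewrite /nb => ->. Qed.

Lemma nb_mem i x c : i < L -> c \in codes (tt i) x -> nb i c \in s.
Proof.
move=> iL /codesP[[ct _]|[a a3 [-> _]]|[a a3 [-> _]]].
- by rewrite nb_local ?mems ?iL //; apply: ltn_trans ct (tile_size_lt _).
- by rewrite nb_l // mems ltn_mod rport_lt ?twist3 // andbT; lia.
- by rewrite nb_r // mems ltn_mod lport_lt ?twist3 // andbT; lia.
Qed.

Lemma nb_complete i x q : (i, x) \in s -> q \in s -> ring_adj L tt (i, x) q ->
  exists2 c, c \in codes (tt i) x & q = nb i c.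
Proof.
case: q => j y; rewrite !mems => /andP[iL xt] /andP[jL yt].
case/or3P=> /andP[/eqP /= e].
- rewrite /= => h; subst j; exists y.
    by rewrite !mem_cat mem_filter h mem_iota yt.
  by rewrite nb_local //; apply: ltn_trans yt (tile_size_lt (tt i)).
- case/hasP=> a a3 /= /andP[/eqP-> /eqP->].
  have {}a3 : a < 3 by move: a3; rewrite !inE => /or3P[] /eqP->.
  by exists (20 + a); [apply: codes_r | rewrite nb_r // -e].
- case/hasP=> a a3 /= /andP[/eqP-> /eqP->].
  have {}a3 : a < 3 by move: a3; rewrite !inE => /or3P[] /eqP->.
  have ej : j = (i + L.-1) %% L by rewrite e succL.
  exists (10 + twist a); first by apply: codes_l; apply: twist3.
  by rewrite nb_l ?twist3 // twistK // -ej.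
Qed.

Lemma nb_inj i x : i < L -> {in codes (tt i) x &, injective (nb i)}.
Proof.
have nbP c : c \in codes (tt i) x -> [\/ nb i c = (i, c),
    exists2 a, a < 3 & c = 10 + a /\ nb i c =
      ((i + L.-1) %% L, rport (tt ((i + L.-1) %% L)) (twist a))
  | exists2 a, a < 3 & c = 20 + a /\ nb i c =
      (i.+1 %% L, lport (tt (i.+1 %% L)) (twist a))].
  case/codesP=> [[ct _]|[a a3 [-> _]]|[a a3 [-> _]]].
  - by constructor 1; rewrite nb_local //; apply: ltn_trans ct (tile_size_lt _).
  - by constructor 2; exists a; rewrite // nb_l.
  - by constructor 3; exists a; rewrite // nb_r.
move=> iL c d /nbP[->|[a a3 [-> ->]]|[a a3 [-> ->]]] /nbP[->|[b b3 [-> ->]]|[b b3 [-> ->]]]; case.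
- by [].
- by move=> /eqP; rewrite eq_sym (negbTE (pred_neq iL)).
- by move=> /eqP; rewrite eq_sym (negbTE (succ_neq iL)).
- by move=> /eqP; rewrite (negbTE (pred_neq iL)).
- move/(rport_inj (twist3 a3) (twist3 b3)) => e.
  by rewrite -(twistK a3) -(twistK b3) e.
- by move=> /eqP; rewrite (negbTE (pred_succ_neq iL)).
- by move=> /eqP; rewrite (negbTE (succ_neq iL)).
- by move=> /eqP; rewrite eq_sym (negbTE (pred_succ_neq iL)).
- by rewrite /lport => e; rewrite -(twistK a3) -(twistK b3) e.
Qed.

Lemma codes_uniq t x : x < tile_size t -> uniq (codes t x).
Proof.
have /allP h : all (fun x => uniq (codes t x)) (full t) by case: t.
by move=> xt; apply: h; rewrite mem_iota.
Qed.

Lemma size3 : 2 < size s.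
Proof.
rewrite (perm_size ps); have sub : {subset [:: (0, 0); (0, 1); (0, 2)] <= ring_vertices L tt}.
  by move=> q; rewrite !inE => /or3P[] /eqP->; rewrite mem_ring; case: (tt 0); rewrite andbT; lia.
by apply: leq_trans (uniq_leq_size _ sub).
Qed.

Lemma used_codes_size i x : (i, x) \in s -> size (used_codes i x) = 2.
Proof.
move=> ixs; have /andP[iL xt] : (i < L) && (x < tile_size (tt i)) by rewrite -mems.
apply: (used_size us (@ring_adjC L tt) cs size3 ixs (codes_uniq xt)).
- exact: nb_inj.
- by move=> c; apply: nb_mem.
- by move=> y; apply: nb_complete.
Qed.

Let U i := used_codes i.

Lemma used_codes_sym i x y : i < L -> x < tile_size (tt i) -> y < tile_size (tt i) ->
  (x \in U i y) = (y \in U i x).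
Proof.
move=> iL xt yt; have tl := tile_size_lt (tt i).
have h a b : a < tile_size (tt i) -> b < tile_size (tt i) ->
    (a \in U i b) = tile_adj (tt i) b a && used s (i, b) (i, a).
  move=> al bl; rewrite mem_filter nb_local; last lia.
  rewrite andbC; congr (_ && _); rewrite !mem_cat mem_filter mem_iota add0n al.
  rewrite !andbT; apply/orP/idP => [[//|]|->]; last by left.
  by case/orP=> /mapP[z _ e]; move: al; rewrite e; lia.
by rewrite !h // tile_adjC usedC.
Qed.

Lemma leaf_checked i : i < L ->
  leaf_check (tt i) (lookup [seq (x, U i x) | x <- rev (full (tt i))]).
Proof.
move=> iL; apply: (@check_all_rev _ (fun asg => leaf_check (tt i) (lookup asg)) (U i))
  (tile_checks (tt i)) => [x|x y].
  rewrite mem_iota => xt; rewrite mem_filter filter_sublists andbT.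
  by rewrite used_codes_size // mems iL.
by rewrite !mem_iota => xt yt; apply: used_codes_sym.
Qed.

Let W i := lookup [seq (x, U i x) | x <- rev (full (tt i))].

Let WE i x : x < tile_size (tt i) -> W i x = U i x.
Proof. by move=> xt; rewrite /W lookupP // mem_rev mem_iota. Qed.

Lemma mem_sublists (T : eqType) (r t : seq T) : r \in sublists t -> {subset r <= t}.
Proof.
elim: t r => [|x t IH] r /=; first by rewrite inE => /eqP->.
rewrite mem_cat => /orP[/IH h|/mapP[r' /IH h ->]] y.
  by move/h; rewrite inE orbC => ->.
by rewrite !inE => /orP[->//|/h ->]; rewrite orbT.
Qed.

Let usedlE i a : a < 3 -> i < L ->
  usedl (tt i) (W i) a = used s (i, lport (tt i) a) (nb i (10 + a)).
Proof.
by move=> a3 iL; rewrite /usedl WE ?lport_lt // mem_filter codes_l // andbT.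
Qed.

Let usedrE i a : a < 3 -> i < L ->
  usedr (tt i) (W i) a = used s (i, rport (tt i) a) (nb i (20 + a)).
Proof.
by move=> a3 iL; rewrite /usedr WE ?rport_lt // mem_filter codes_r // andbT.
Qed.

Let usedr_l i a : a < 3 -> i < L ->
  usedr (tt i) (W i) a = usedl (tt (i.+1 %% L)) (W (i.+1 %% L)) (twist a).
Proof.
move=> a3 iL; have i1 : i.+1 %% L < L by rewrite ltn_mod; lia.
rewrite usedrE // usedlE ?twist3 // nb_r // nb_l ?twist3 // succL // twistK //.
by rewrite usedC.
Qed.

Lemma next_code i x : (i, x) \in s ->
  exists c, [/\ c \in U i x, next s (i, x) = nb i c & c \in codes (tt i) x].
Proof.
move=> ixs; have nadj : ring_adj L tt (i, x) (next s (i, x)) by apply: next_cycle.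
have ns : next s (i, x) \in s by rewrite mem_next.
have [c cc ec] := nb_complete ixs ns nadj.
by exists c; split=> //; rewrite mem_filter cc andbT -ec /used eqxx.
Qed.

(** A closed part would trap the cycle in one tile, although it also visits the next one. *)
Lemma no_closed_part i S : i < L -> S \in sublists (full (tt i)) ->
  closed_part (W i) S = false.
Proof.
move=> iL /mem_sublists sub; apply/negP => /andP[S0 /allP cl].
have [x xS] : exists x, x \in S by case: S S0 {sub cl} => // x S _; exists x; rewrite mem_head.
pose P := [seq (i, y) | y <- S]; pose R p q := (p \in P) ==> (q \in P).
have lt y : y \in S -> y < tile_size (tt i) by move/sub; rewrite mem_iota.
have tR : transitive R by move=> b a c; rewrite /R; case: (a \in P); case: (b \in P).
have := @next_invariant _ s us R tR _ (i, x) (i.+1 %% L, 0).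
rewrite !mems iL lt // ltn_mod /R map_f //=.
have -> : 0 < L by lia.
have -> : 0 < tile_size (tt (i.+1 %% L)) by case: (tt _).
move=> h; have : (i.+1 %% L, 0) \in P.
  apply: h => // p ps'; apply/implyP => /mapP[y yS e]; subst p.
  have [c [cU -> _]] := next_code ps'.
  have cS : c \in S by apply: (allP (cl y yS)); rewrite WE ?lt.
  by rewrite nb_local ?map_f //; apply: ltn_trans (lt _ cS) (tile_size_lt _).
by case/mapP=> y _ [e _]; move: (succ_neq iL); rewrite e eqxx.
Qed.

Lemma counts i : i < L ->
  countl (tt i) (W i) + countl (tt (i.+1 %% L)) (W (i.+1 %% L)) = 4.
Proof.
move=> iL; have := leaf_checked iL; rewrite /leaf_check anyE -/(W i).
rewrite (_ : has _ _ = false) => [/andP[/eqP <- _]|]; last first.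
  by apply/hasPn => S Sin; rewrite no_closed_part.
congr (_ + _); rewrite /countl /countr /= !usedr_l //= !addn0.
by rewrite [in RHS]addnCA addnC addnA [in RHS]addnC addnA.
Qed.

(** By [counts] the numbers of used strands alternate between [c] and [4 - c]; around a ring of odd
    length this forces [c = 2]. *)
Lemma countl2 i : i < L -> countl (tt i) (W i) = 2.
Proof.
pose f j := countl (tt (j %% L)) (W (j %% L)).
have L0 : 0 < L by lia.
have fS j : f j + f j.+1 = 4.
  rewrite /f; have := @counts (j %% L); rewrite ltn_mod => /(_ L0).
  by rewrite -[in (j %% L).+1 %% L]addn1 modnDml addn1.
have alt j : f j = if odd j then 4 - f 0 else f 0.
  elim: j => // j IH; have := fS j; rewrite IH /=; have := fS 0.
  case: (odd j) => /=; lia.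
have f0 : f 0 = 2.
  have fL : f L = f 0 by rewrite /f modnn mod0n.
  have := alt L; rewrite oddL fL; have := fS 0; lia.
move=> iL; rewrite -{1 2}(modn_small iL) -/(f i) alt f0; by case: ifP.
Qed.

Let cpart i := nth [::] [seq S <- sublists (full (tt i)) | coloring (tt i) (W i) S] 0.

Lemma cpartP i : i < L -> [/\ coloring (tt i) (W i) (cpart i),
  has (fun a => usedl (tt i) (W i) a && shade a (holel (tt i) (W i))) [:: 0; 1; 2]
  & has (fun a => usedl (tt i) (W i) a && ~~ shade a (holel (tt i) (W i))) [:: 0; 1; 2]].
Proof.
move=> iL; have := leaf_checked iL; rewrite /leaf_check anyE -/(W i).
rewrite (_ : has _ _ = false); last first.
  by apply/hasPn => S Sin; rewrite no_closed_part.
case/andP=> _; rewrite countl2 //= anyE => /and3P[hS -> ->]; split=> //.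
rewrite /cpart; move: hS; rewrite has_filter; case E: [seq _ <- _ | _] => [|S r] // _ /=.
have : S \in S :: r by rewrite mem_head.
by rewrite -E mem_filter => /andP[].
Qed.

Let color (p : nat * nat) := p.2 \in cpart p.1.

Lemma color_seam i a : a < 3 -> i < L -> usedr (tt i) (W i) a ->
  color (i, rport (tt i) a) =
  color (i.+1 %% L, lport (tt (i.+1 %% L)) (twist a)).
Proof.
move=> a3 iL ra; have i1 : i.+1 %% L < L by rewrite ltn_mod; lia.
have ain : a \in [:: 0; 1; 2] by case: a a3 {ra} => [|[|[|]]].
have tain : twist a \in [:: 0; 1; 2] by case: a a3 {ra ain} => [|[|[|]]].
have [/and3P[_ _ /allP hr] _ _] := cpartP iL.
have [/and3P[_ /allP hl _] _ _] := cpartP i1.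
have := hr a ain; rewrite ra => /eqP; rewrite /color /= => ->.
have := hl _ tain; rewrite -usedr_l // ra => /eqP ->.
have : countl (tt (i.+1 %% L)) (W (i.+1 %% L)) = 2 by apply: countl2.
move: ra; rewrite /countl /holel /holer /=.
rewrite !usedr_l //=.
move: (usedl _ _ 0) (usedl _ _ 1) (usedl _ _ 2) => [] [] [] //=;
  by case: a a3 {ain tain hr hl} => [|[|[|]]].
Qed.

(** The colour is constant along the cycle, inside tiles and across seams, yet both colours occur in
    tile 0. *)
Lemma ring_not_hamiltonian : False.
Proof.
have L0 : 0 < L by lia.
pose R p q := color p == color q.
have tR : transitive R by move=> b a c /eqP ab /eqP bc; rewrite /R ab bc.
have inv p : p \in s -> R p (next s p).
  case: p => i x ixs; have [c [cU -> cc]] := next_code ixs.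
  move: (ixs); rewrite mems => /andP[iL xt].
  case/codesP: cc => [[ct _]|[a a3 [ec ex]]|[a a3 [ec ex]]].
  - have c10 := ltn_trans ct (tile_size_lt _).
    rewrite nb_local // /R /color /= eq_sym.
    have [/and3P[/allP hc _ _] _ _] := cpartP iL.
    have := hc x; rewrite mem_iota => /(_ xt)/allP/(_ c).
    by rewrite WE // c10 => /(_ cU).
  - subst c x; rewrite nb_l // /R.
    have j1 : (i + L.-1) %% L < L by rewrite ltn_mod.
    have := @color_seam ((i + L.-1) %% L) (twist a) (twist3 a3) j1.
    rewrite predL // twistK // => -> //.
    rewrite usedr_l ?twist3 // predL // twistK // usedlE //.
    by move: cU; rewrite mem_filter => /andP[].
  - subst c x; rewrite nb_r // /R color_seam // usedrE //.
    by move: cU; rewrite mem_filter => /andP[].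
have [_ /hasP[a ain /andP[ua sa]] /hasP[b bin /andP[ub sb]]] := cpartP L0.
have a3 : a < 3 by move: ain; rewrite !inE => /or3P[] /eqP->.
have b3 : b < 3 by move: bin; rewrite !inE => /or3P[] /eqP->.
have := @next_invariant _ s us R tR inv (0, lport (tt 0) a) (0, lport (tt 0) b).
rewrite !mems L0 !lport_lt // => /(_ isT isT); rewrite /R /color /=.
have [/and3P[_ /allP ca _] _ _] := cpartP L0.
have := ca a ain; have := ca b bin; rewrite ua ub /= => /eqP -> /eqP ->.
by rewrite sa (negbTE sb).
Qed.

End RingNotHamiltonian.

(* Besides non-Hamiltonicity and Hamiltonian paths between nonadjacent        *)
(* vertices, asks for a path missing a single vertex between adjacent ones;   *)
(* pendant edges can then be attached to every vertex.                        *)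
Record strongly_mnh (T : eqType) (e : rel T) (vs : seq T) (el : seq (T * T)) : Prop := {
  mnh_sym : symmetric e;
  mnh_irr : irreflexive e;
  mnh_uniq : uniq vs;
  mnh_edges : forall u v, u \in vs -> v \in vs -> e u v -> (u, v) \in el \/ (v, u) \in el;
  mnh_cycle : forall s, perm_eq s vs -> ~~ cycle e s;
  mnh_path : forall u v, u \in vs -> v \in vs -> u != v ->
    exists r q, [/\ chain e u v q, perm_eq (r ++ q) vs & size r <= e u v]
}.

(** * Rings of every order from 28 on, except 29 *)

(** The deltas start at position 2, so that for [j <= 3] and [L >= 7] none is next to the bowtie at
    position 0. *)
Definition ring_tile (b : bool) (j i : nat) :=
  if i == 0 then (if b then Bowtie else Star) else
  if 2 <= i < 2 + j then Delta else Star.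

Definition ring_edges L tt : seq ((nat * nat) * (nat * nat)) :=
  flatten [seq [seq ((i, p.1), (i, p.2)) | p <- tile_edges (tt i)] ++
               [seq ((i, rport (tt i) s), (i.+1 %% L, lport (tt (i.+1 %% L)) (twist s)))
               | s <- [:: 0; 1; 2]] | i <- iota 0 L].

Section RingMnh.

Variables (L j : nat) (b : bool).
Hypotheses (L7 : 7 <= L) (oddL : odd L) (j3 : j <= 3).

Local Notation tt := (ring_tile b j).

Lemma ring_path u v : u \in ring_vertices L tt -> v \in ring_vertices L tt -> u != v ->
  exists r q, [/\ chain (ring_adj L tt) u v q, perm_eq (r ++ q) (ring_vertices L tt)
    & size r <= ring_adj L tt u v].
Proof.
wlog: u v / u.1 <= v.1.
  move=> H uin vin uv; have [h|h] := leqP u.1 v.1; first exact: H.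
  have [|r [q [cq pq sr]]] := H v u (ltnW h) vin uin; first by rewrite eq_sym.
  exists r, (rev q); split; last by rewrite ring_adjC.
    exact: chain_rev (@ring_adjC _ _) _ _ _ cq.
  by apply: perm_trans pq; rewrite perm_cat2l; apply/permEl/perm_rev.
case: u v => k x [k' y] /= kk'; rewrite !mem_ring => /andP[kL xk] /andP[k'L yk'] xy.
suff [om [q [cq pq h]]] : exists om q, [/\ chain (ring_adj L tt) (k, x) (k', y) q,
    perm_eq ((if om is Some m then [:: (k, m)] else [::]) ++ q) (ring_vertices L tt)
    & om = None \/ ring_adj L tt (k, x) (k', y)].
  exists (if om is Some m then [:: (k, m)] else [::]), q; split=> //.
  by case: h => [->|->] //; case: om {pq}.
move: kk'; rewrite leq_eqVlt => /orP[/eqP e|kk'].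
  subst k'; apply: self_path => //; by apply: contraNneq xy => ->.
apply: span_path => //; first by rewrite kk'.
set n := (k' - k).-1; set n' := L - 2 - n.
have on : odd (n + n') by rewrite /n' subnKC /n ?oddB ?oddL //; lia.
have n5 : 5 <= n + n' by rewrite /n' /n; lia.
have gs := gapsP on n5.
have [e|e] : tt k' = Star \/ tt k' = Delta.
  by rewrite /ring_tile; case: ifP => [|_]; [lia | case: ifP => _; auto].
  by rewrite e; apply: (@span_star (tt k) (gap n, gap n')).
rewrite e; apply: (@span_delta (tt k) (gap n, gap n')).
(* A bowtie is at position 0 only and deltas at positions 2 to 4, so both runs between them are
   nonempty. *)
case ek: (tt k) => //; apply: inner_gapsP => //.
  move: e ek; rewrite /ring_tile /n; case: (k =P 0) => [->|_].
    by case: ifP => [|_]; [lia | case: ifP => //; lia].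
  by move=> _; case: ifP.
move: e ek; rewrite /ring_tile /n' /n; case: (k =P 0) => [->|_].
  by case: ifP => [|_]; [lia | case: ifP => //; lia].
by move=> _; case: ifP.
Qed.

Lemma ring_edgesP u v : u \in ring_vertices L tt -> v \in ring_vertices L tt ->
  ring_adj L tt u v -> (u, v) \in ring_edges L tt \/ (v, u) \in ring_edges L tt.
Proof.
case: u v => k x [k' y]; rewrite !mem_ring => /andP[kL xk] /andP[k'L yk'].
have seam i z w s : i < L -> s \in [:: 0; 1; 2] -> z == rport (tt i) s ->
    w == lport (tt (i.+1 %% L)) (twist s) ->
    ((i, z), (i.+1 %% L, w)) \in ring_edges L tt.
  move=> iL sin /eqP-> /eqP->; apply/flatten_mapP; exists i; first by rewrite mem_iota.
  by rewrite mem_cat; apply/orP; right; apply: (map_f (fun s => (_, _)) sin).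
case/or3P=> /andP[/eqP /= e].
- have inn z w : (z, w) \in tile_edges (tt k) -> ((k, z), (k, w)) \in ring_edges L tt.
    move=> zw; apply/flatten_mapP; exists k; first by rewrite mem_iota.
    by rewrite mem_cat; apply/orP; left; apply: (map_f (fun p => ((k, p.1), (k, p.2))) zw).
  by rewrite /= => /orP[/inn|/inn]; rewrite -e; [left|right].
- by rewrite e => /hasP[s sin /andP[/= zs ws]]; left; apply: seam zs ws.
- by rewrite e => /hasP[s sin /andP[/= zs ws]]; right; apply: seam zs ws.
Qed.

Lemma ring_irr : irreflexive (ring_adj L tt).
Proof.
case=> k x; rewrite /ring_adj /= eqxx /=.
have -> : tile_adj (tt k) x x = false.
  rewrite /tile_adj orbb; apply/negP.
  have : all (fun p => p.1 != p.2) (tile_edges (tt k)) by case: (tt k).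
  by move/allP => h /h; rewrite eqxx.
have -> : (k == k.+1 %% L) = false.
  apply/negP => /eqP e; have L0 : 0 < L by lia.
  have kL : k < L by rewrite e ltn_mod.
  by have := succ_neq (leq_trans (isT : 2 < 7) L7) kL; rewrite -e eqxx.
by [].
Qed.

Lemma ring_sum (f : tile -> nat) :
  sumn [seq f (tt i) | i <- iota 0 L] =
  L * f Star + j * f Delta + b * f Bowtie - (j + b) * f Star.
Proof.
have -> : L = 7 + (L - 7) by lia.
rewrite iotaD map_cat sumn_cat.
have -> : [seq f (tt i) | i <- iota (0 + 7) (L - 7)] = nseq (L - 7) (f Star).
  rewrite -[in RHS](size_iota 7 (L - 7)) -(size_map (fun i => f (tt i))).
  apply/all_pred1P/allP => _ /mapP[i + ->]; rewrite mem_iota /ring_tile /= => h.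
  by case: ifP => [|_]; [lia | case: ifP => [|//]; lia].
rewrite sumn_nseq mulnDl [f Star * _]mulnC; move: ((L - 7) * f Star) => X.
by case: (j) j3 => [|[|[|[|]]]] // _; case: (b); rewrite /ring_tile /=; lia.
Qed.

Lemma ring_size : size (ring_vertices L tt) = 4 * L + 2 * j + 3 * b.
Proof.
rewrite size_flatten /shape -map_comp.
rewrite (eq_map (g := fun i => tile_size (tt i))); last first.
  by move=> i; rewrite /= size_map size_iota.
by rewrite ring_sum /=; case: b; lia.
Qed.

Lemma ring_edges_size : size (ring_edges L tt) = 6 * L + 3 * j + 5 * b.
Proof.
rewrite size_flatten /shape -map_comp.
rewrite (eq_map (g := fun i => size (tile_edges (tt i)) + 3)); last first.
  by move=> i; rewrite /= size_cat !size_map.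
by rewrite (ring_sum (fun t => size (tile_edges t) + 3)) /=; case: b; lia.
Qed.

Lemma ring_mnh : strongly_mnh (ring_adj L tt) (ring_vertices L tt) (ring_edges L tt).
Proof.
split.
- exact: ring_adjC.
- exact: ring_irr.
- exact: ring_uniq.
- exact: ring_edgesP.
- move=> s ps; apply/negP => cs; apply: (ring_not_hamiltonian _ oddL ps cs); lia.
- exact: ring_path.
Qed.

End RingMnh.

(** The parity of [r] decides about the bowtie, the rest of the residue modulo 8 is the number of
    deltas. For [r = 29] only 5 tiles would result. *)
Lemma ring_exists r : 28 <= r -> r != 29 ->
  exists (e : rel (nat * nat)) vs el,
    [/\ strongly_mnh e vs el, size vs = r & size el = uphalf (3 * r)].
Proof.
move=> r28 r29.
pose b := odd r; pose m := r - 3 * b - 4.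
pose L := (2 * (m %/ 8)).+1; pose j := (m %% 8) %/ 2.
have er : odd r = (r %% 2 == 1) :> nat by rewrite modn2; case: (odd r).
have m20 : 24 <= m by rewrite /m /b; lia.
have oL : odd L by rewrite /L /= oddM.
have L7 : 7 <= L by rewrite /L; lia.
have j3 : j <= 3 by rewrite /j; lia.
have eq : r = 4 * L + 2 * j + 3 * b by rewrite /L /j /m /b; lia.
exists (ring_adj L (ring_tile b j)), (ring_vertices L (ring_tile b j)),
  (ring_edges L (ring_tile b j)); split.
- exact: ring_mnh.
- by rewrite ring_size.
- by rewrite ring_edges_size //; rewrite [in RHS]eq; case: (b); lia.
Qed.

(** * A graph with 29 vertices *)

(* The Loupekine snark on 22 vertices with two vertices replaced by triangles *)
(* and an edge, with its ends, replaced by a bowtie.                          *)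
Definition nbrs29 : seq (seq nat) := [::
  [:: 1; 26; 27; 28]; [:: 0; 5; 28]; [:: 4; 5; 21]; [:: 5; 6; 20];
  [:: 2; 6; 26]; [:: 1; 2; 3]; [:: 3; 4; 10]; [:: 8; 11; 28];
  [:: 7; 12; 14]; [:: 11; 22; 23]; [:: 6; 12; 13]; [:: 7; 9; 13];
  [:: 8; 10; 22]; [:: 10; 11; 25]; [:: 8; 15; 18]; [:: 14; 19; 27];
  [:: 18; 19; 21]; [:: 19; 24; 25]; [:: 14; 16; 20]; [:: 15; 16; 17];
  [:: 3; 18; 24]; [:: 2; 16; 23]; [:: 9; 12; 23]; [:: 9; 21; 22];
  [:: 17; 20; 25]; [:: 13; 17; 24]; [:: 0; 4; 27]; [:: 0; 15; 26];
  [:: 0; 1; 7]].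

Definition adj29 : rel nat := fun x y => y \in nth [::] nbrs29 x.

Definition edges29 :=
  flatten [seq [seq (x, y) | y <- nth [::] nbrs29 x & x < y] | x <- iota 0 29].

(* One number for each pair [u < v]: below a leading 1, the binary digits     *)
(* choose the successive vertices of the path among the unvisited neighbours. *)
(* For adjacent vertices the five lowest digits give the omitted vertex.      *)
Definition turns29 : seq (seq positive) := ([::
  [:: 56299; 31735; 7611; 27574; 56213; 1957; 31885; 13006; 2027; 6846; 1899;
      7399; 1766; 893; 14774; 7694; 7170; 14731; 13314; 3238; 1941; 478; 117;
      422; 437; 24819; 3559; 25268];
  [:: 65094; 63078; 28627; 28107; 27501; 106645; 26014; 3541; 13694; 3413;
      13115; 467; 7617; 27901; 15219; 3517; 14769; 3549; 6478; 3859; 958;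
      973; 846; 926; 28619; 6869; 31530];
  [:: 56811; 99123; 103880; 27606; 30430; 25438; 2014; 26795; 1886; 14046;
      3294; 3728; 30164; 7273; 1897; 7446; 3433; 6223; 1550; 13294; 3579;
      207; 8023; 30768; 7059; 4023];
  [:: 13526; 29483; 15251; 28098; 28066; 894; 12971; 878; 13145; 883; 7457;
      28899; 15437; 7713; 28182; 13857; 7308; 1717; 1765; 1629; 12515; 6515;
      6742; 7131; 8127];
  [:: 14073; 107498; 25167; 27016; 7652; 27473; 7588; 27592; 904; 7112;
      53497; 15764; 14724; 25447; 24665; 6454; 7688; 1615; 1993; 822; 461;
      27427; 56755; 7983];
  [:: 13999; 52882; 14110; 1771; 3858; 1707; 3090; 846; 3809; 3870; 13686;
      1798; 14745; 3334; 13394; 7649; 1554; 466; 3683; 1921; 14414; 7270;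
      26440];
  [:: 32307; 25778; 7547; 27029; 7531; 6632; 8147; 862; 7975; 6562; 3875;
      3582; 6947; 6456; 1726; 6376; 3432; 824; 434; 28985; 7070; 3883];
  [:: 64748; 105005; 30435; 55108; 53722; 3473; 31696; 55351; 13907; 14288;
      14019; 13776; 13329; 119; 14893; 7040; 3089; 3703; 27315; 211; 28491];
  [:: 14658; 12667; 12610; 16234; 3361; 64716; 7791; 14559; 7351; 15349;
      13046; 6855; 3995; 26945; 891; 1782; 50359; 4025; 1759; 27100];
  [:: 1732; 13747; 3944; 56461; 6882; 3566; 3492; 2014; 4066; 2006; 6629;
      872; 7379; 27925; 3180; 1754; 3428; 1590; 3560];
  [:: 1749; 64875; 7461; 14064; 3908; 1776; 13914; 13774; 12878; 3880; 1620;
      2025; 6864; 1557; 6931; 3946; 1908; 3802];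
  [:: 1972; 6728; 6883; 6710; 1746; 3551; 4067; 3543; 3638; 436; 4005; 32433;
      1590; 3483; 1714; 1591; 1780];
  [:: 8001; 4044; 6750; 3485; 3441; 6882; 3505; 3782; 417; 16202; 15747;
      1978; 844; 7242; 449; 8109];
  [:: 56251; 13467; 14491; 16239; 7669; 16235; 26759; 13163; 3993; 7307;
      26755; 7493; 16341; 3227; 32526];
  [:: 54419; 6423; 16315; 31948; 15803; 6820; 53; 941; 7033; 1700; 1846;
      13238; 16105; 445];
  [:: 52694; 115369; 54744; 54984; 32431; 13784; 7135; 982; 32175; 1803;
      26035; 29512; 25567];
  [:: 104273; 29606; 120070; 32499; 1683; 7582; 6571; 14161; 3799; 6517;
      15599; 13821];
  [:: 3806; 6886; 7772; 210; 1996; 864; 54603; 13762; 13278; 8040; 1778];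
  [:: 6190; 13188; 3577; 836; 1698; 49467; 827; 7993; 7602; 25012];
  [:: 3886; 209; 998; 432; 13751; 29219; 3631; 6800; 1777];
  [:: 198; 840; 1721; 8011; 27347; 8124; 52108; 442];
  [:: 6979; 3086; 1948; 1707; 13717; 8041; 7656];
  [:: 14517; 1573; 3226; 6587; 901; 3746];
  [:: 385; 6277; 6587; 7893; 15265];
  [:: 3366; 1919; 7918; 1769];
  [:: 894; 7478; 25557];
  [:: 12499; 15021];
  [:: 14025];
  [::]])%positive.

(** A forced step consumes no digit; otherwise 0 takes the first candidate and 1 discards it. *)
Fixpoint turn (cs : seq nat) (p : positive) : nat * positive :=
  match cs, p with
  | [:: y], _ => (y, p)
  | y :: _, xO q => (y, q)
  | _ :: cs', xI q => turn cs' q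
  | y :: _, xH => (y, p)
  | [::], _ => (0, p)
  end.

Fixpoint follow n x (visited : seq nat) (p : positive) : seq nat :=
  if n is n'.+1 then
    let: (y, q) := turn [seq y <- nth [::] nbrs29 x | y \notin visited] p in
    y :: follow n' y (y :: visited) q
  else [::].

Fixpoint low_bits n (p : positive) : nat * positive :=
  if n is n'.+1 then
    match p with
    | xO q => let: (m, q') := low_bits n' q in (m.*2, q')
    | xI q => let: (m, q') := low_bits n' q in (m.*2.+1, q')
    | xH => (0, p)
    end
  else (0, p).

Definition path29 u v : seq nat * seq nat :=
  let p := nth xH (nth [::] turns29 u) (v - u.+1) in
  if adj29 u v then
    let: (m, q) := low_bits 5 p in ([:: m], u :: follow 27 u [:: u; m] q)
  else ([::], u :: follow 28 u [:: u] p).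

Definition path29_check u v :=
  let: (r, q) := path29 u v in
  [&& chain adj29 u v q, size (r ++ q) == 29, uniq (r ++ q) & all (gtn 29) (r ++ q)].

Lemma path29_checks : all (fun u => all (path29_check u) (iota u.+1 (28 - u))) (iota 0 29).
Proof. by vm_compute. Qed.

(** Following the chosen edges over 29 vertices from 0 lists the whole cycle through 0, possibly
    with repetitions. [escapes] certifies that this cycle misses a vertex, and [two_factors29] does
    so for all 2-factors. *)
Definition walk29 (asg : seq (nat * seq nat)) : seq nat :=
  let U := lookup asg in
  (fix go n x y := if n is n'.+1 then
     x :: go n' y (if nth 0 (U y) 0 == x then nth 0 (U y) 1 else nth 0 (U y) 0)
     else [::]) 29 0 (nth 0 (U 0) 0).

Definition escapes (U : nat -> seq nat) S :=
  [&& closed_part U S, all (gtn 29) S & ~~ all (mem S) (iota 0 29)].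

Definition leaf29 asg := escapes (lookup asg) (walk29 asg).

(* An order in which most vertices come after two of their neighbours.        *)
Definition order29 := [:: 24; 25; 17; 19; 13; 11; 10; 12; 22; 9; 23; 20; 7; 8; 18; 16;
  21; 14; 15; 3; 6; 2; 4; 5; 26; 27; 0; 28; 1].

Lemma two_factors29 :
  check_all (fun x => pairs_of (nth [::] nbrs29 x)) leaf29 order29 [::].
Proof. by vm_compute. Qed.

Lemma order29E : order29 =i iota 0 29.
Proof. by apply: perm_mem; vm_compute. Qed.

Lemma adj29_lt x y : adj29 x y -> (x < 29) && (y < 29).
Proof.
have nb : all (all (gtn 29)) nbrs29 by vm_compute.
rewrite /adj29; have [x29|x29] := ltnP x 29; last by rewrite nth_default.
move=> yx; apply: (allP (allP nb _ _)) yx; exact: mem_nth.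
Qed.

Lemma adj29C : symmetric adj29.
Proof.
have sym : all (fun x => all (fun y => adj29 y x) (nth [::] nbrs29 x)) (iota 0 29).
  by vm_compute.
suff h x y : adj29 x y -> adj29 y x by move=> x y; apply/idP/idP; apply: h.
move=> xy; have /andP[x29 _] := adj29_lt xy.
have xin : x \in iota 0 29 by rewrite mem_iota.
exact: (allP (allP sym x xin)).
Qed.

Lemma adj29_irr : irreflexive adj29.
Proof.
have irr : all (fun x => ~~ adj29 x x) (iota 0 29) by vm_compute.
move=> x; apply/negP => xx; have /andP[x29 _] := adj29_lt xx.
by have := allP irr x; rewrite mem_iota xx => /(_ x29).
Qed.

Lemma path29P u v : u < 29 -> v < 29 -> u != v ->
  exists r q, [/\ chain adj29 u v q, perm_eq (r ++ q) (iota 0 29) & size r <= adj29 u v].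
Proof.
wlog: u v / u < v.
  move=> H u29 v29 uv; have [h|h|e] := ltngtP u v; first exact: H.
    have [|r [q [cq pq sr]]] := H v u h v29 u29; first by rewrite eq_sym.
    exists r, (rev q); split; last by rewrite adj29C.
      exact: chain_rev adj29C _ _ _ cq.
    by apply: perm_trans pq; rewrite perm_cat2l; apply/permEl/perm_rev.
  by rewrite e eqxx in uv.
move=> uv u29 v29 _; have uin : u \in iota 0 29 by rewrite mem_iota.
have vin : v \in iota u.+1 (28 - u) by rewrite mem_iota; lia.
have := allP (allP path29_checks u uin) v vin; rewrite /path29_check.
case E: path29 => [r q] /and4P[cq /eqP sz uq /allP lt].
exists r, q; split=> //; last first.
  by move: E; rewrite /path29; case: ifP => _; [case: low_bits => m p|]; case=> <-.
apply: uniq_perm => //.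
have sub : {subset r ++ q <= iota 0 29} by move=> x /lt; rewrite mem_iota.
have [|_ eqi] := uniq_min_size uq sub; first by rewrite sz.
exact: eqi.
Qed.

Lemma not_hamiltonian29 s : perm_eq s (iota 0 29) -> ~~ cycle adj29 s.
Proof.
move=> ps; apply/negP => cs.
have us : uniq s by rewrite (perm_uniq ps) iota_uniq.
have mems x : (x \in s) = (x < 29) by rewrite (perm_mem ps) mem_iota.
pose U x := [seq c <- nth [::] nbrs29 x | used s x c].
have U2 x : x \in s -> size (U x) = 2.
  move=> xs; apply: (used_size us adj29C cs) => //.
  - by rewrite (perm_size ps).
  - have un : all uniq nbrs29 by vm_compute.
    by apply: (allP un); apply: mem_nth; rewrite -mems.
  - by move=> c xc; rewrite mems; case/andP: (adj29_lt xc).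
  - by move=> y _ xy; exists y.
have : leaf29 [seq (x, U x) | x <- rev order29].
  apply: (@check_all_rev _ leaf29 U order29 _ _ two_factors29) => [x|x y].
    rewrite order29E -(perm_mem ps) => xs.
    by rewrite mem_filter filter_sublists U2.
  rewrite !order29E -!(perm_mem ps) => xs ys; rewrite !mem_filter usedC.
  by congr (_ && _); exact: adj29C.
have look x : x \in s -> lookup [seq (x, U x) | x <- rev order29] x = U x.
  by move=> xs; rewrite lookupP // mem_rev order29E -(perm_mem ps).
rewrite /leaf29; move: (lookup _) look (walk29 _) => W look S.
case/and3P=> /andP[S0 /allP cl] /allP lt /negP; apply.
pose R (x y : nat) := (x \in S) ==> (y \in S).
have tR : transitive R by move=> b a c; rewrite /R; case: (a \in S); case: (b \in S).
have inv x : x \in s -> R x (next s x).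
  move=> xs; apply/implyP => xS; apply: (allP (cl x xS)).
  rewrite look // mem_filter /used eqxx; exact: next_cycle cs xs.
have [x xS] : exists x, x \in S by case: (S) S0 => // x l _; exists x; rewrite mem_head.
apply/allP => y; rewrite -(perm_mem ps) => ys.
have xs : x \in s by rewrite mems; apply: lt.
by have := next_invariant us tR inv xs ys; rewrite /R xS.
Qed.

Lemma mnh29 : strongly_mnh adj29 (iota 0 29) edges29.
Proof.
split.
- exact: adj29C.
- exact: adj29_irr.
- exact: iota_uniq.
- have h x y : adj29 x y -> x < y -> (x, y) \in edges29.
    move=> xy lt; apply/flatten_mapP; exists x.
      by rewrite mem_iota; case/andP: (adj29_lt xy).
    by rewrite map_f // mem_filter lt.
  move=> x y _ _ xy; have [lt|lt|e] := ltngtP x y; first by left; apply: h.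
    by right; apply: h; rewrite // adj29C.
  by move: xy; rewrite e adj29_irr.
- exact: not_hamiltonian29.
- by move=> u v; rewrite !mem_iota; apply: path29P.
Qed.

Lemma mnh_exists r : 28 <= r ->
  exists (T : eqType) (e : rel T) vs el,
    [/\ strongly_mnh e vs el, size vs = r & size el = uphalf (3 * r)].
Proof.
move=> r28; have [->|r29] := eqVneq r 29.
  exists nat, adj29, (iota 0 29), edges29; split=> //; exact: mnh29.
by have [e [vs [el h]]] := ring_exists r28 r29; exists (nat * nat)%type, e, vs, el.
Qed.

(** * Copies glued at a vertex, with cliques attached *)

(** The properties of [strongly_mnh] that survive gluing: no cycle on [r] or more vertices, and
    paths on at least [r] vertices, or [r - 1] if the ends are adjacent. *)
Record core (r : nat) (T : eqType) (e : rel T) (vs : seq T) (el : seq (T * T)) : Prop := {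
  core_sym : symmetric e;
  core_irr : irreflexive e;
  core_uniq : uniq vs;
  core_edges : forall u v, u \in vs -> v \in vs -> e u v -> (u, v) \in el \/ (v, u) \in el;
  core_short : forall s, uniq s -> all (mem vs) s -> cycle e s -> size s < r;
  core_long : forall u v, u \in vs -> v \in vs -> u != v ->
    exists p, [/\ upath e u v p, all (mem vs) p & r <= (size p).+1 + e u v]
}.

Lemma mnh_core (T : eqType) (e : rel T) vs el :
  strongly_mnh e vs el -> core (size vs) e vs el.
Proof.
case=> sym irr uvs edg ham pth; split=> //.
  move=> s us sv cs; have := uniq_leq_size us (allP sv).
  rewrite leq_eqVlt => /orP[/eqP sz|//].
  have [_ eqi] := uniq_min_size us (allP sv) (eq_leq (esym sz)).
  by have := ham s (uniq_perm us uvs eqi); rewrite cs.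
move=> u v uin vin uv; have [w [q [cq pq sr]]] := pth u v uin vin uv.
case: q cq pq => // z p /and3P[/eqP-> pp lp] pq.
have uq : uniq (u :: p).
  by have := perm_uniq pq; rewrite uvs cat_uniq => /and3P[].
exists p; split; first by rewrite /upath pp lp.
  by apply/allP => x xp; rewrite /= -(perm_mem pq) mem_cat inE xp !orbT.
by have := perm_size pq; rewrite size_cat /=; lia.
Qed.

Lemma sumn_map_const (A : Type) (f : A -> nat) (s : seq A) n :
  (forall x, f x = n) -> sumn (map f s) = size s * n.
Proof. by move=> h; elim: s => //= x s ->; rewrite h mulSn. Qed.

Lemma glue_arith r a b (x y z : bool) : 3 <= r ->
  r <= a.+1 + x -> r <= b.+1 + y -> r <= (a + b).+1 + z.
Proof. by case: x; case: y; case: z; lia. Qed.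

Section Glue.

Variables (r : nat) (T : eqType) (e : rel T) (vs : seq T) (el : seq (T * T)).
Hypothesis coreE : core r e vs el.
Hypothesis r3 : 3 <= r.
Variables (c : T) (k : nat).
Hypotheses (cvs : c \in vs) (k0 : 0 < k).

(* [k] copies of the graph sharing the vertex [c], which is kept as [(0, c)]. *)
Definition copy i x := (if x == c then 0 else i, x).
Definition glue_adj (p q : nat * T) :=
  e p.2 q.2 && [|| p.1 == q.1, p.2 == c | q.2 == c].
Definition glue_vertices :=
  (0, c) :: flatten [seq [seq (i, x) | x <- rem c vs] | i <- iota 0 k].
Definition glue_edges :=
  flatten [seq [seq (copy i a.1, copy i a.2) | a <- el] | i <- iota 0 k].

Lemma mem_glue p : (p \in glue_vertices) =
  (p.2 \in vs) && (if p.2 == c then p.1 == 0 else p.1 < k).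
Proof.
case: p => i x; rewrite inE /= xpair_eqE.
have uvs := core_uniq coreE.
have -> : ((i, x) \in flatten [seq [seq (i0, x0) | x0 <- rem c vs] | i0 <- iota 0 k]) =
   (i < k) && (x \in rem c vs).
  apply/flatten_mapP/andP => [[j]|[ik xr]].
    by rewrite mem_iota => jk /mapP[y yr [-> ->]].
  by exists i; rewrite ?mem_iota ?map_f.
rewrite mem_rem_uniq // !inE; have [->|xc] := eqVneq x c.
  by rewrite cvs andbF orbF andbT.
by rewrite andbF /= andbC.
Qed.

Lemma copyK p : p \in glue_vertices -> copy p.1 p.2 = p.
Proof.
rewrite mem_glue /copy; case: p => i x /=; case: eqP => // _ /andP[_ /eqP->].
by [].
Qed.

Lemma copy_in i x : i < k -> x \in vs -> copy i x \in glue_vertices.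
Proof. by move=> ik xv; rewrite mem_glue /copy /= xv; case: eqP. Qed.

Lemma copy_inj i : injective (copy i).
Proof. by move=> x y []. Qed.

Lemma copy_adj i x y : glue_adj (copy i x) (copy i y) = e x y.
Proof.
rewrite /glue_adj /copy /=; case: (x =P c); case: (y =P c); rewrite ?eqxx ?orbT ?andbT //.
Qed.

Lemma copy_path i x y : i < k -> x \in vs -> y \in vs -> x != y ->
  exists p, [/\ upath glue_adj (copy i x) (copy i y) (map (copy i) p),
    all (mem vs) p & r <= (size p).+1 + e x y].
Proof.
move=> ik xv yv xy; have [p [/and3P[pp /eqP lp up] pv rp]] := core_long coreE xv yv xy.
exists p; split=> //; apply/and3P; split.
- by rewrite path_map; apply: sub_path pp => a b; rewrite /relpre /= copy_adj.
- by rewrite last_map lp.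
- by rewrite -map_cons map_inj_uniq //; apply: copy_inj.
Qed.

Lemma glue_irr : irreflexive glue_adj.
Proof. by case=> i x; rewrite /glue_adj (core_irr coreE). Qed.

Lemma glueC : symmetric glue_adj.
Proof.
move=> p q; rewrite /glue_adj (core_sym coreE) eq_sym; congr (_ && (_ || _)).
by rewrite orbC.
Qed.

Lemma same_copy p q : p \in glue_vertices -> q \in glue_vertices -> p != q ->
  [|| p.1 == q.1, p.2 == c | q.2 == c] ->
  exists2 i, i < k & copy i p.2 = p /\ copy i q.2 = q.
Proof.
move=> pv qv pq h; have := pv; have := qv; rewrite !mem_glue.
move/(copyK): (pv) => ep; move/(copyK): (qv) => eq'.
have [pc|pc] := eqVneq p.2 c; last first.
  move=> /andP[_ hq] /andP[_ pk]; exists p.1 => //; split=> //.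
  move: h; rewrite (negbTE pc) /= => /orP[/eqP->//|qc].
  by rewrite -{2}eq' /copy qc.
have [qc|qc] := eqVneq q.2 c.
  move=> /andP[_ /eqP q0] /andP[_ /eqP p0].
  by rewrite (surjective_pairing p) (surjective_pairing q) p0 q0 pc qc eqxx in pq.
move=> /andP[_ qk] _; exists q.1 => //; split=> //.
by rewrite -{2}ep /copy pc eqxx.
Qed.

(** By [cycle_cut] at the shared vertex a cycle stays in one copy. For ends in different copies, the
    paths to [c] combine to one on at least [2 r - 3 >= r] vertices. *)
Lemma glue_core : core r glue_adj glue_vertices glue_edges.
Proof.
split.
- exact: glueC.
- exact: glue_irr.
- rewrite /glue_vertices /= -/(allpairs_dep _ _ _); apply/andP; split.
    apply/negP => /allpairsPdep[i [x [_ xr [_ e2]]]].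
    by move: xr; rewrite -e2 mem_rem_uniqF // (core_uniq coreE).
  apply: allpairs_uniq_dep; rewrite ?iota_uniq //.
    by move=> i _; apply: rem_uniq; apply: (core_uniq coreE).
  by move=> [i x] [j y] _ _ /= [-> ->].
- move=> p q pv qv /[dup] pq /andP[epq h].
  have neq : p != q by apply: contraTneq pq => ->; rewrite glue_irr.
  have [i ik [ep eq']] := same_copy pv qv neq h.
  have [pv2 qv2] : p.2 \in vs /\ q.2 \in vs.
    by move: pv qv; rewrite !mem_glue => /andP[-> _] /andP[-> _].
  have [ab|ba] := core_edges coreE pv2 qv2 epq; [left|right];
    apply/flatten_mapP; exists i; rewrite ?mem_iota //; apply/mapP.
    by exists (p.2, q.2); rewrite //= ep eq'.
  by exists (q.2, p.2); rewrite //= ep eq'.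
- move=> s us sv cs; have [hs|hs] := boolP (has (predC1 (0, c)) s); last first.
    have : {subset s <= [:: (0, c)]}.
      by move=> x xs; move/hasPn: hs => /(_ x xs); rewrite /= negbK inE.
    by move/(uniq_leq_size us) => /= h; lia.
  case/hasP: hs => x xs xc.
  have vin p : p \in s -> p \in glue_vertices by move/(allP sv).
  have ncut p : p \in s -> p != (0, c) -> p.2 != c.
    move=> /vin; rewrite mem_glue => /andP[_]; case: (p.2 =P c) => // pc /eqP p0.
    by rewrite (surjective_pairing p) p0 pc eqxx.
  have alls := @cycle_cut _ glue_adj s [pred p | p.1 == x.1] (0, c) us cs.
  have {}alls : all (predU [pred p | p.1 == x.1] (pred1 (0, c))) s.
    apply: alls => [a b ais bis ac bc /andP[_] /=|]; last first.
      by apply/hasP; exists x; rewrite //= eqxx.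
    rewrite (negbTE (ncut _ ais ac)) (negbTE (ncut _ bis bc)) !orbF => /eqP->.
    by [].
  have inj : {in s &, injective (@snd nat T)}.
    move=> p q ps qs e2; move: (allP alls p ps) (allP alls q qs) => /=.
    case/orP=> /eqP ep /orP[] /eqP eq'.
    - by rewrite (surjective_pairing p) (surjective_pairing q) ep eq' e2.
    - have pc : p.2 = c by rewrite e2 eq'.
      move: (vin _ ps); rewrite eq' mem_glue pc eqxx => /andP[_ /eqP p0].
      by rewrite (surjective_pairing p) p0 pc.
    - have qc : q.2 = c by rewrite -e2 ep.
      move: (vin _ qs); rewrite ep mem_glue qc eqxx => /andP[_ /eqP q0].
      by rewrite (surjective_pairing q) q0 qc.
    - by rewrite ep eq'.
  rewrite -(size_map snd); apply: (core_short coreE).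
  - by rewrite map_inj_in_uniq.
  - by apply/allP => _ /mapP[p /vin + ->]; rewrite mem_glue => /andP[].
  - by rewrite cycle_map; apply: sub_cycle cs => a b /andP[].
move=> p q pv qv pq.
have [pv2 qv2] : p.2 \in vs /\ q.2 \in vs.
  by move: pv qv; rewrite !mem_glue => /andP[-> _] /andP[-> _].
have mapin i w : i < k -> all (mem vs) w -> all (mem glue_vertices) (map (copy i) w).
  by move=> ik /allP wv; apply/allP => _ /mapP[z zw ->]; apply: copy_in => //; apply: wv.
have [h|] := boolP [|| p.1 == q.1, p.2 == c | q.2 == c].
  have [i ik [ep eq']] := same_copy pv qv pq h.
  have neq : p.2 != q.2 by apply: contraNneq pq => e2; rewrite -ep -eq' e2.
  have [w [uw wv rw]] := copy_path ik pv2 qv2 neq.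
  exists (map (copy i) w); rewrite -{1}ep -{1}eq' size_map; split=> //.
    exact: mapin.
  by rewrite -ep -eq' copy_adj.
rewrite !negb_or => /and3P[ij pc qc].
have [pk qk] : p.1 < k /\ q.1 < k.
  by move: pv qv; rewrite !mem_glue (negbTE pc) (negbTE qc) => /andP[_ ->] /andP[_ ->].
have [w [uw wv rw]] := copy_path pk pv2 cvs pc.
rewrite eq_sym in qc.
have [w' [uw' wv' rw']] := copy_path qk cvs qv2 qc.
have c0 i : copy i c = (0, c) by rewrite /copy eqxx.
rewrite !c0 !copyK // in uw uw'.
exists (map (copy p.1) w ++ map (copy q.1) w'); split.
- apply: (upath_cat uw uw'); apply/hasPn => _ /mapP[z zw ->].
  have zc : z != c.
    case/and3P: uw' => _ _ /andP[+ _]; apply: contraNneq => zc.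
    by rewrite -(c0 q.1) -zc map_f.
  rewrite -[p in p :: _](copyK pv) -map_cons; apply/negP => /mapP[y _].
  by rewrite /copy (negbTE zc) => -[]; case: eqP => [->|_] e1 e2;
     [rewrite e2 eqxx in zc | rewrite e1 eqxx in ij].
- by rewrite all_cat !mapin.
- by rewrite size_cat !size_map; apply: glue_arith r3 rw rw'.
Qed.

Lemma size_glue : size glue_vertices = k * (size vs).-1 + 1.
Proof.
rewrite /= size_flatten /shape -map_comp (@sumn_map_const _ _ _ (size vs).-1).
  by rewrite size_iota addn1.
by move=> i; rewrite /= size_map size_rem.
Qed.

Lemma size_glue_edges : size glue_edges = k * size el.
Proof.
rewrite size_flatten /shape -map_comp (@sumn_map_const _ _ _ (size el)).
  by rewrite size_iota.
by move=> i; rewrite /= size_map.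
Qed.

End Glue.

Section Hang.

Variables (r : nat) (T : eqType) (e : rel T) (vs : seq T) (el : seq (T * T)).
Hypothesis coreE : core r e vs el.
Hypothesis r3 : 4 <= r.
Variable m : T -> nat.
Hypothesis m13 : forall x, 0 < m x <= 3.

(** Each vertex [x] becomes the root [(x, 0)] of a clique on [m x] vertices: a single vertex, a
    pendant edge or a triangle. *)
Definition hang_adj (p q : T * nat) :=
  (p.1 == q.1) && (p.2 != q.2) || [&& p.2 == 0, q.2 == 0 & e p.1 q.1].
Definition hang_vertices := flatten [seq [seq (x, i) | i <- iota 0 (m x)] | x <- vs].
Definition clique_pairs n :=
  flatten [seq [seq (i, j) | i <- iota 0 j] | j <- iota 0 n].
Definition hang_edges :=
  [seq ((a.1, 0), (a.2, 0)) | a <- el] ++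
  flatten [seq [seq ((x, a.1), (x, a.2)) | a <- clique_pairs (m x)] | x <- vs].

Lemma mem_hang p : (p \in hang_vertices) = (p.1 \in vs) && (p.2 < m p.1).
Proof.
case: p => x i; apply/flatten_mapP/andP => [[y yv /mapP[j]]|[/= xv im]].
  by rewrite mem_iota => jm [-> ->].
by exists x => //; rewrite map_f // mem_iota.
Qed.

Lemma hangC : symmetric hang_adj.
Proof.
move=> p q; rewrite /hang_adj [p.1 == _]eq_sym [p.2 == q.2]eq_sym (core_sym coreE).
by congr (_ || _); rewrite andbCA.
Qed.

Lemma hang_irr : irreflexive hang_adj.
Proof. by move=> p; rewrite /hang_adj !eqxx (core_irr coreE) !andbF. Qed.

Lemma hang_edgesP p q : p \in hang_vertices -> q \in hang_vertices ->
  hang_adj p q -> (p, q) \in hang_edges \/ (q, p) \in hang_edges.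
Proof.
case: p q => x i [y j]; rewrite !mem_hang => /= /andP[xv im] /andP[yv jm].
case/orP=> [/andP[/= /eqP e1 ij]|/and3P[/= /eqP i0 /eqP j0 xy]].
  subst y; have h a b : a < b -> b < m x -> ((x, a), (x, b)) \in hang_edges.
    move=> ab bm; rewrite mem_cat; apply/orP; right; apply/flatten_mapP.
    exists x => //; apply: (map_f (fun a => ((x, a.1), (x, a.2))) (x := (a, b))).
    by apply/flatten_mapP; exists b; rewrite ?mem_iota // map_f // mem_iota.
  have [lt|lt|e2] := ltngtP i j; [left|right|]; try exact: h.
  by rewrite e2 eqxx in ij.
subst i j; have [h|h] := core_edges coreE xv yv xy; [left|right]; rewrite mem_cat;
  by rewrite (map_f (fun a => ((a.1, 0), (a.2, 0))) h).
Qed.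

(** By [cycle_cut] at a root, a cycle through a vertex that is not a root stays in one clique, so it
    has at most 3 vertices. *)
Lemma hang_short s : uniq s -> all (mem hang_vertices) s -> cycle hang_adj s -> size s < r.
Proof.
move=> us sv cs; have [/hasP[p ps p2]|hs] := boolP (has (fun p => p.2 != 0) s).
  have alls : all (predU [pred q | q.1 == p.1] (pred1 (p.1, 0))) s.
    apply: (@cycle_cut _ hang_adj s _ _ us cs) => [a b ais bis ac bc|]; last first.
      apply/hasP; exists p => //=; rewrite eqxx /=.
      by apply: contraNneq p2 => ->.
    case/orP=> [/andP[/eqP e1 _]|/and3P[/eqP a0 /eqP b0 _]] /=; first by rewrite e1.
    rewrite (surjective_pairing a) a0 in ac; rewrite (surjective_pairing b) b0 in bc.
    by move: ac bc; rewrite !xpair_eqE !andbT => /negbTE-> /negbTE->.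
  have : {subset s <= [:: (p.1, 0); (p.1, 1); (p.1, 2)]}.
    move=> q qs; have : q.1 == p.1 by move: (allP alls q qs) => /= /orP[|/eqP->].
    move=> /eqP e1; move: (allP sv q qs) (m13 q.1).
    rewrite /= mem_hang => /andP[_] + /andP[_]; rewrite (surjective_pairing q) -e1 /=.
    case: (q.2) => [|[|[|n]]] h1 h2; rewrite !inE !xpair_eqE eqxx //=.
    by have := leq_trans h1 h2.
  by move/(uniq_leq_size us) => /= h; lia.
have s0 p : p \in s -> p.2 = 0.
  by move=> ps; move/hasPn: hs => /(_ p ps); rewrite negbK => /eqP.
rewrite -(size_map fst); apply: (core_short coreE).
- rewrite map_inj_in_uniq // => p q ps qs e1.
  by rewrite (surjective_pairing p) (surjective_pairing q) e1 !s0.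
- apply/allP => _ /mapP[p ps ->]; have := allP sv p ps.
  by rewrite /= mem_hang => /andP[].
- rewrite cycle_map; apply: (@sub_in_cycle _ (mem s)) cs; last exact/allP.
  by move=> a b ais bis; rewrite /hang_adj /= !s0 // andbF.
Qed.

(** The core path between the two roots lacks a vertex only if the roots are adjacent. Then [p] and
    [q], being nonadjacent, are not both roots, and an end that is no root supplies that vertex. *)
Lemma hang_long p q : p \in hang_vertices -> q \in hang_vertices -> p != q ->
  ~~ hang_adj p q ->
  exists w, [/\ upath hang_adj p q w, all (mem hang_vertices) w & r <= (size w).+1].
Proof.
move=> pv qv pq npq; have := pv; have := qv; rewrite !mem_hang.
move=> /andP[qv1 qm] /andP[pv1 pm].
have neq : p.1 != q.1.
  apply: contraNneq npq => e1; rewrite /hang_adj e1 eqxx /=.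
  by apply/orP; left; apply: contraNneq pq => e2; rewrite (surjective_pairing p) e1 e2;
     case: (q).
have [w0 [/and3P[pw /eqP lw uw] wv rw]] := core_long coreE pv1 qv1 neq.
pose lift (x : T) := (x, 0).
have li : injective lift by move=> x y [].
have lv x : x \in vs -> lift x \in hang_vertices.
  by move=> xv; rewrite mem_hang xv; case/andP: (m13 x).
have up0 : upath hang_adj (lift p.1) (lift q.1) (map lift w0).
  apply/and3P; split.
  - rewrite path_map; apply: sub_path pw => a b ab.
    by rewrite /relpre /hang_adj /= ab orbT.
  - by rewrite last_map lw.
  - by rewrite -map_cons map_inj_uniq.
have al0 : all (mem hang_vertices) (map lift w0).
  by apply/allP => _ /mapP[x xw ->]; apply: lv; apply: (allP wv).
have up1 : exists w, [/\ upath hang_adj p (lift q.1) w, all (mem hang_vertices) w,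
    size w = size w0 + (p.2 != 0) & {subset w <= map lift (p.1 :: w0)}].
  have [p0|p0] := eqVneq p.2 0.
    exists (map lift w0); rewrite size_map addn0; split=> //.
      by rewrite (surjective_pairing p) p0.
    by move=> x xw; rewrite map_cons inE xw orbT.
  exists (map lift (p.1 :: w0)); rewrite size_map /= addn1; split=> //.
  - case/and3P: up0 => h1 h2 h3; apply/and3P; split=> //=.
      by rewrite h1 andbT /hang_adj /= eqxx p0.
    apply/andP; split; last exact: h3.
    apply/negP => pin; suff : p \in map lift (p.1 :: w0).
      by case/mapP=> x _ e2; rewrite e2 eqxx in p0.
    exact: pin.
  - by rewrite lv ?al0.
have [w1 [u1 a1 s1 sub1]] := up1.
have [q0|q0] := eqVneq q.2 0.
  exists w1; split=> //; first by rewrite (surjective_pairing q) q0.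
  rewrite s1; move: npq; rewrite /hang_adj (negbTE neq) /= q0 /=.
  move: rw; case: (p.2 == 0) => /=.
    by move=> + /negbTE h; rewrite h !addn0.
  by case: (e _ _); rewrite ?addn1 ?addn0 // => /leqW.
exists (w1 ++ [:: q]); split.
- apply: upath_cat u1 _ _.
    by rewrite /upath /= /hang_adj /= eqxx eq_sym q0 eqxx /= inE andbT;
       apply: contraNneq q0 => <-.
  rewrite /= orbF inE negb_or eq_sym pq /=.
  by apply/negP => /sub1 /mapP[x _ e2]; rewrite e2 eqxx in q0.
- by rewrite all_cat a1 /= qv.
- rewrite size_cat s1 /= addn1; apply: leq_trans rw _.
  by rewrite -addSn -addnS leq_add // -[X in X <= _]/(nat_of_bool _); case: (e _ _).
Qed.

Lemma sat_hang : sat (size hang_vertices) (cycles_ge r) <= size hang_edges.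
Proof.
apply: (sat_leq (e := hang_adj)).
- lia.
- exact: hangC.
- exact: hang_irr.
- rewrite /hang_vertices -/(allpairs_dep _ _ _); apply: allpairs_uniq_dep.
  + exact: core_uniq coreE.
  + by move=> x _; apply: iota_uniq.
  + by move=> [x i] [y j] _ _ /= [-> ->].
- exact: hang_edgesP.
- exact: hang_short.
- exact: hang_long.
Qed.

End Hang.

Section Counting.

Variables (N p t : nat).
Hypothesis ptN : t + p <= N.

Definition mult i := if i < t then 3 else if i < t + p then 2 else 1.

Lemma sum_mult (f : nat -> nat) :
  sumn [seq f (mult i) | i <- iota 0 N] = t * f 3 + p * f 2 + (N - t - p) * f 1.
Proof.
rewrite [in LHS](_ : N = t + (p + (N - t - p))); last lia.
have const a n d : (forall i, a <= i < a + n -> mult i = d) ->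
    sumn [seq f (mult i) | i <- iota a n] = n * f d.
  move=> h; rewrite mulnC -sumn_nseq; congr sumn.
  rewrite -[in RHS](size_iota a n) -(size_map (fun i => f (mult i))).
  by apply/all_pred1P/allP => _ /mapP[i + ->]; rewrite mem_iota => /h ->; rewrite /= eqxx.
rewrite !iotaD !map_cat !sumn_cat (const _ t 3) ?(const _ p 2) ?(const _ (N - t - p) 1).
- by rewrite addnA.
- by move=> i h; rewrite /mult; case: ifP => [|_]; [lia | case: ifP => //; lia].
- by move=> i h; rewrite /mult; case: ifP => [|_]; [lia | case: ifP => //; lia].
- by move=> i h; rewrite /mult; case: ifP => //; lia.
Qed.

End Counting.

(** From [k] glued copies, [p] pendant edges add one vertex and one edge each, [t] triangles two
    vertices and three edges each, at distinct vertices. *)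
Lemma sat_upper r k p t : 28 <= r -> 0 < k -> t + p <= k * r.-1 + 1 ->
  sat (k * r.-1 + 1 + p + 2 * t) (cycles_ge r) <= k * uphalf (3 * r) + p + 3 * t.
Proof.
move=> r28 k0 ptN; have [T [e [vs [el [mnh sv sl]]]]] := mnh_exists r28.
have coreE := mnh_core mnh; rewrite sv in coreE.
have [c cvs] : exists c, c \in vs.
  by case: (vs) sv => [r0|c s _]; [rewrite -r0 in r28 | exists c; rewrite mem_head].
have r3 : 3 <= r by lia.
have coreG := glue_core coreE r3 cvs k0.
pose gv := glue_vertices vs c k.
have sg : size gv = k * r.-1 + 1 by rewrite size_glue // sv.
pose m x := mult p t (index x gv).
have m13 x : 0 < m x <= 3 by rewrite /m /mult; case: ifP => // _; case: ifP.
have r4 : 4 <= r by lia.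
have := sat_hang coreG r4 m13; rewrite -/gv.
have sum (f : nat -> nat) : sumn [seq f (m x) | x <- gv] =
    t * f 3 + p * f 2 + (k * r.-1 + 1 - t - p) * f 1.
  rewrite -sum_mult // -sg; congr sumn.
  rewrite -[in LHS](mkseq_nth (0, c) gv) /mkseq -map_comp; apply/eq_in_map => i.
  rewrite mem_iota /= => im; rewrite /m index_uniq //.
  exact: (core_uniq coreG).
have -> : size (hang_vertices gv m) = k * r.-1 + 1 + p + 2 * t.
  rewrite size_flatten /shape -map_comp.
  rewrite (eq_map (g := fun x => id (m x))); last by move=> x; rewrite /= size_map size_iota.
  by rewrite (sum id) /=; lia.
have -> : size (hang_edges gv (glue_edges el c k) m) = k * uphalf (3 * r) + p + 3 * t.
  rewrite size_cat size_map size_glue_edges sl size_flatten /shape -map_comp.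
  rewrite (eq_map (g := fun x => size (clique_pairs (m x)))); last first.
    by move=> x; rewrite /= size_map.
  by rewrite (sum (fun n => size (clique_pairs n))) /=; lia.
by [].
Qed.

(** * Counting edges *)

Import Order.TTheory GRing.Theory Num.Theory.
Local Open Scope ring_scope.

(** With [N = k (r - 1) + 1], pendant edges suffice up to [n = 2 N]. Beyond that every vertex
    carries a pendant edge or a triangle, and [p], [t] solve [p + t = N] and [N + p + 2 t = n]. *)
Lemma sat_copies n r k : (28 <= r)%N -> (0 < k)%N ->
  (k * r.-1 + 1 <= n)%N -> (n <= 3 * (k * r.-1 + 1))%N ->
  (2 * sat n (cycles_ge r) <= 2 * n + k * (r + 7) \/
   2 * sat n (cycles_ge r) + 3 * (k * r) <= 4 * n + 7 * k /\ 2 * (k * r.-1 + 1) < n)%N.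
Proof.
move=> r28 k0 lo hi; have [h|h] := leqP n (2 * (k * r.-1 + 1))%N.
  left; have := @sat_upper r k (n - (k * r.-1 + 1)) 0 r28 k0.
  have -> : (k * r.-1 + 1 + (n - (k * r.-1 + 1)) + 2 * 0 = n)%N by lia.
  move=> /(_ ltac:(lia)) le.
  have u : (2 * uphalf (3 * r) <= 3 * r + 1)%N by lia.
  nia.
right; split=> //.
have := @sat_upper r k (3 * (k * r.-1 + 1) - n) (n - 2 * (k * r.-1 + 1)) r28 k0.
have -> : (k * r.-1 + 1 + (3 * (k * r.-1 + 1) - n) + 2 * (n - 2 * (k * r.-1 + 1)) = n)%N by lia.
move=> /(_ ltac:(lia)) le.
have u : (2 * uphalf (3 * r) <= 3 * r + 1)%N by lia.
nia.
Qed.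

Lemma sat_one n r : (28 <= r)%N -> (r <= n <= 2 * r)%N ->
  (sat n (cycles_ge r) <= n + uphalf r)%N.
Proof.
move=> r28 /andP[lo hi]; have := @sat_upper r 1 (n - r) 0 r28 isT.
have -> : (1 * r.-1 + 1 + (n - r) + 2 * 0 = n)%N by lia.
move=> /(_ ltac:(lia)); lia.
Qed.

Lemma sat_asymptotic n r : (56 <= r <= n)%N ->
  (sat n (cycles_ge r))%:R <= g (r%:R / n%:R) * n%:R + 4 * (n%:R / r%:R) :> rat.
Proof.
case/andP=> r56 rn; set s := sat n _; have r28 : (28 <= r)%N by lia.
have R0 : (0 : rat) < r%:R by rewrite ltr0n; lia.
have N0 : (0 : rat) < n%:R by rewrite ltr0n; lia.
(* Rounding costs at most [7 k / 2] edges for [k] copies; this is where the error term with constant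
   4 comes from. *)
have err k : (k * r <= n)%N -> (k%:R : rat) <= n%:R / r%:R.
  by move=> kr; rewrite ler_pdivlMr // -natrM ler_nat.
rewrite /g; set k := gk _; case: ifPn => [x12|].
  have n2r : (n <= 2 * r)%N.
    rewrite -(ler_nat rat) natrM; move: x12; rewrite ler_pdivlMr //; lra.
  have le := @sat_one n r r28; rewrite rn n2r in le.
  have {le} : (2 * s <= 2 * n + r + 1)%N by have := le isT; lia.
  rewrite -(ler_nat rat) !(natrM, natrD) => le.
  have e1 := err 1%N; rewrite mul1n in e1; have {}e1 := e1 rn.
  have -> : (1 + 1 / 2 * (r%:R / n%:R)) * n%:R = n%:R + r%:R / 2 :> rat.
    by field; rewrite gt_eqF.
  lra.
rewrite -ltNge => x12.
have n2r : (2 * r < n)%N.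
  rewrite -(ltr_nat rat) natrM; move: x12; rewrite ltr_pdivrMr //; lra.
have [klo khi] : ((k.-1 * (2 * r) <= n) /\ (n < k * (2 * r)))%N.
  have x2 : 0 <= (2 * (r%:R / n%:R) : rat)^-1.
    by rewrite invr_ge0 mulr_ge0 // divr_ge0 // ltW.
  have /andP[] := truncn_itv x2; rewrite -[Num.truncn _]/(k.-1) -[k.-1.+1]/k.
  have -> : (2 * (r%:R / n%:R))^-1 = n%:R / (2 * r)%:R :> rat.
    by rewrite natrM; field; rewrite !gt_eqF.
  have R2 : (0 : rat) < (2 * r)%:R by rewrite ltr0n; lia.
  by rewrite ler_pdivlMr // ltr_pdivrMr // -!natrM ler_nat ltr_nat.
have k2 : (2 <= k)%N by rewrite ltnNge; apply/negP => k1; nia.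
have kr : (k * r <= n)%N.
  have : (k * r <= k.-1 * (2 * r))%N by rewrite mulnA leq_mul2r; apply/orP; right; lia.
  lia.
have K43 : (0 : rat) < 4 * k%:R - 3.
  by have : (2 : rat) <= k%:R; [rewrite ler_nat | lra].
case: ifPn => [xk|].
  have {}xk : (r * (4 * k) <= 2 * n + 3 * r)%N.
    rewrite -(ler_nat rat) !(natrM, natrD); move: xk.
    rewrite ler_pdivrMr // mulrAC ler_pdivlMr //; lra.
  have := @sat_copies n r k r28; rewrite -/s => /(_ ltac:(lia)) h.
  (* Either bound of [h] gives this, since [n < 2 k r] makes [4 n - 3 k r] at most [2 n + k r]. *)
  have {h} : (2 * s <= 2 * n + k * r + 7 * k)%N.
    have lo : (k * r.-1 + 1 <= n)%N by nia.
    have hi : (n <= 3 * (k * r.-1 + 1))%N by nia.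
    by case: (h lo hi); nia.
  rewrite -(ler_nat rat) natrM !(natrM, natrD) => le.
  have e1 := err k kr.
  have -> : (1 + k%:R / 2 * (r%:R / n%:R)) * n%:R = n%:R + k%:R * r%:R / 2 :> rat.
    by field; rewrite gt_eqF.
  lra.
rewrite -ltNge => xk.
have {}xk : (2 * n + 3 * r < r * (4 * k))%N.
  rewrite -(ltr_nat rat) !(natrM, natrD); move: xk.
  rewrite ltr_pdivlMr // mulrAC ltr_pdivrMr //; lra.
have := @sat_copies n r k.-1 r28; rewrite -/s => /(_ ltac:(lia)) h.
(* With [k - 1] copies [2 (k - 1) r <= n] reverses the comparison, so again either bound gives
   this. *)
have {h} : (2 * s + 3 * (k.-1 * r) <= 4 * n + 7 * k.-1)%N.
  have lo : (k.-1 * r.-1 + 1 <= n)%N by nia.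
  have hi : (n <= 3 * (k.-1 * r.-1 + 1))%N by nia.
  by case: (h lo hi); nia.
rewrite -(ler_nat rat) !(natrM, natrD) -subn1 natrB; last lia; move=> le.
have e1 := err k kr.
have -> : (2 - (3 * k%:R - 3) / 2 * (r%:R / n%:R)) * n%:R =
    2 * n%:R - 3 * (k%:R - 1) * r%:R / 2 :> rat.
  by field; rewrite gt_eqF.
lra.
Qed.

Theorem theorem1p5 :
  (exists C : rat, forall n r : nat, (56 <= r <= n)%N ->
     (sat n (cycles_ge r))%:R
       <= g (r%:R / n%:R) * n%:R + C * (n%:R / r%:R))
  /\
  (forall n r : nat,
     28 <= n%:R / 2 :> rat -> n%:R / 2 <= r%:R :> rat -> (r <= n)%N ->
     sat n (cycles_ge r) = (n + uphalf r)%N).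
Proof.
split; first by exists 4; apply: sat_asymptotic.
move=> n r n28 n2r rn.
have n56 : (56 <= n)%N by rewrite -(ler_nat rat); lra.
have {}n2r : (n <= 2 * r)%N by rewrite -(ler_nat rat) natrM; lra.
apply/eqP; rewrite eqn_leq sat_geq ?sat_one ?rn //; lia.
Qed.
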